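(* Consider a networked system with graph $\mathcal G=(\mathcal V,\mathcal E)$ and matrices $A,B,Q,R$ as in the context. Suppose there are $L>1$, $\alpha\in(0,1)$, $\gamma\in(0,1)$ such that (a) $\|A\|,\|B\|,\|Q\|,\|R\|\le L$; (b) $R\succeq\gamma I$; (c) $(A,B)$ is $(L,\alpha)$-stabilizable; (d) $Q\succeq 0$ and $(A,Q^{1/2})$ is $(L,\alpha)$-detectable. Suppose also that $p$ is a subexponential function with $|\{j\in\mathcal V: d_{\mathcal G}(i,j)=d\}|\le p(d)$ for all $i\in\mathcal V$ and all integers $d\ge0$. Let $\rho,\Upsilon,L_P,\delta,\Psi$ be the constants defined in the context and set $$\beta:=\Big(1-\frac{1-\rho^2}{2\Upsilon^2}\Big)^{1/2},\qquad \Omega:=\Big(\frac{\Upsilon^2}{1-\rho^2}\Big)^{1/2},\qquad \overline\kappa:=\frac{1}{\log\delta}\log\!\left(\frac{1-\rho^2}{2\Upsilon^2\Psi L\big(L\Psi+2L(1+L_PL^2/\gamma)\big)}\right).$$ If $\kappa\ge0$ is an integer with $\kappa\ge\overline\kappa$, then $\Phi^\kappa:=A-BK^\kappa$ is $(\Omega,\beta)$-stable, where $K^\kappa$ is the $\kappa$-truncation of the optimal LQR gain $K^\star$. Furthermore, $\beta\in(0,1)$.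
   Context: Setting. $\mathcal G=(\mathcal V,\mathcal E)$ is a finite undirected graph without self-loops, $\mathcal V=\{1,\dots,N\}$; $d_{\mathcal G}(i,j)$ is the number of edges in a shortest path from $i$ to $j$ ($+\infty$ if there is no path). Each node $i$ has a state $x_i(t)\in\mathbb R^{n_{x_i}}$ and control $u_i(t)\in\mathbb R^{n_{u_i}}$. Real blocks $A_{ij}\in\mathbb R^{n_{x_i}\times n_{x_j}}$, $B_{ij}\in\mathbb R^{n_{x_i}\times n_{u_j}}$, $Q_{ij}\in\mathbb R^{n_{x_i}\times n_{x_j}}$, $R_{ij}\in\mathbb R^{n_{u_i}\times n_{u_j}}$ are given, with $Q_{ij}=Q_{ji}^\top$, $R_{ij}=R_{ji}^\top$, and all four blocks equal to zero whenever $i\ne j$ and $\{i,j\}\notin\mathcal E$. Set $A=\{A_{ij}\}$, $B=\{B_{ij}\}$, $Q=\{Q_{ij}\}$, $R=\{R_{ij}\}$ (block matrices indexed by $i,j\in\mathcal V$), $x=\{x_i\}_{i\in\mathcal V}$, $u=\{u_i\}_{i\in\mathcal V}$. $\|\cdot\|$ is the Euclidean norm for vectors and the induced 2-norm for matrices; $M\succeq M'$ means $M-M'$ is positive semidefinite. A function $p:\mathbb Z_{\ge0}\to[0,\infty)$ is subexponential if $p(d)r^d\to0$ as $d\to\infty$ for every $r\in(0,1)$. Stability notions, for $L>0$, $\alpha\in[0,1)$: a square matrix $\Phi$ is $(L,\alpha)$-stable if $\|\Phi^t\|\le L\alpha^t$ for all integers $t\ge 0$; $(A,B)$ is $(L,\alpha)$-stabilizable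 if there is $\overline K$ with $\|\overline K\|\le L$ and $A-B\overline K$ $(L,\alpha)$-stable; $(A,C)$ is $(L,\alpha)$-detectable if $(A^\top,C^\top)$ is $(L,\alpha)$-stabilizable. Linear-quadratic regulator (LQR): minimize $\sum_{t=0}^\infty \tfrac12 x(t)^\top Qx(t)+\tfrac12u(t)^\top Ru(t)$ subject to $x(0)=\overline x$, $x(t+1)=Ax(t)+Bu(t)$ for $t\ge0$. The optimal policy is the linear feedback $u=-K^\star x$; explicitly $K^\star=(R+B^\top P^\star B)^{-1}B^\top P^\star A$, where $P^\star$ is the unique positive semidefinite solution of $P=A^\top PA-A^\top PB(R+B^\top PB)^{-1}B^\top PA+Q$. $K^\star$ is partitioned into blocks $K^\star_{ij}\in\mathbb R^{n_{u_i}\times n_{x_j}}$. The $\kappa$-truncated gain $K^\kappa=\{K^\kappa_{ij}\}$ has $K^\kappa_{ij}=K^\star_{ij}$ if $d_{\mathcal G}(i,j)\le\kappa$ and $K^\kappa_{ij}=0$ otherwise. Constants (in terms of $L,\alpha,\gamma,p$): $\gamma_F=\frac{(1-\alpha)^2}{L^2(1+L)^2}$, $\gamma_G=\frac{(1-\alpha)^2\gamma}{2L^4(1+L)^2}$, $L_P=\frac{L^3(1+L^2)}{1-\alpha^2}$, $L_H=\max(2L+1,\,L_P+1)$, $\overline\mu=\big(2L_H^2/\gamma_G+\gamma_G+L_H\big)/\gamma_F$, $\gamma_H=\Big(\frac{2}{\gamma_G}+\big(1+\frac{4L_H}{\gamma_G}+\frac{4L_H^2}{\gamma_G^2}\big)\frac{L_H(1+\overline\mu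 L_H)}{\gamma_F}+\overline\mu\Big)^{-1}$, $\rho=\Big(\frac{L_H^2-\gamma_H^2}{L_H^2+\gamma_H^2}\Big)^{1/2}$, $\Upsilon=\frac{L_H}{\gamma_H^2\,\rho}$, $\delta=\frac{\rho+1}{2}$, $\Psi=\big(\sup_{d\in\mathbb Z_{\ge0}}p(d)(\rho/\delta)^d\big)\frac{\Upsilon\delta}{1-\delta}$. *)

(* Defs.v *)
From HB Require Import structures.
From mathcomp Require Export all_boot all_order all_algebra.
From mathcomp Require Export all_classical all_reals all_analysis.
Export Order.TTheory GRing.Theory Num.Theory.
Export numFieldNormedType.Exports.

Set Implicit Arguments.
Unset Strict Implicit.
Unset Printing Implicit Defensive.

Local Open Scope classical_set_scope.
Local Open Scope ring_scope.

Definition walk (T : finType) (e : rel T) (i j : T) (n : nat) : bool :=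
  [exists s : n.-tuple T, path e i s && (last i s == j)].

(* Graph distance; [None] stands for +oo (no path). *)
Definition gdist (T : finType) (e : rel T) (i j : T) : option nat :=
  match pselect (exists n, walk e i j n) with
  | left ex => Some (ex_minn ex)
  | right _ => None
  end.

Definition gdist_le (T : finType) (e : rel T) (i j : T) (k : nat) : bool :=
  if gdist e i j is Some d then (d <= k)%N else false.

Definition graph_sparse (R : realType) (N : nat) (e : rel 'I_N)
    (m n : 'I_N -> nat) (M : forall i j, 'M[R]_(m i, n j)) : Prop :=
  forall i j, i != j -> ~~ e i j -> M i j = 0.

(* The norm that the library puts on matrices is the entrywise maximum, so the
   Euclidean norm and its induced operator norm are defined here. *)
Definition norm2 (R : realType) (n : nat) (v : 'cV[R]_n) : R :=
  Num.sqrt (\sum_i v i 0 ^+ 2).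

Definition opnorm (R : realType) (m n : nat) (M : 'M[R]_(m, n)) : R :=
  sup [set norm2 (M *m v) | v in [set v : 'cV[R]_n | norm2 v <= 1]].

Definition psdmx (R : realType) (n : nat) (M : 'M[R]_n) : Prop :=
  M^T = M /\ forall v : 'cV[R]_n, 0 <= (v^T *m M *m v) 0 0.

Definition loewner_ge (R : realType) (n : nat) (M M' : 'M[R]_n) : Prop :=
  psdmx (M - M').

Definition is_psd_sqrt (R : realType) (n : nat) (M S : 'M[R]_n) : Prop :=
  psdmx S /\ S *m S = M.

Definition stable (R : realType) (L alpha : R) (n : nat) (Phi : 'M[R]_n) : Prop :=
  forall t : nat, opnorm (Phi ^+ t) <= L * alpha ^+ t.

Definition stabilizable (R : realType) (L alpha : R) (n m : nat)
    (A : 'M[R]_n) (B : 'M[R]_(n, m)) : Prop :=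
  exists K : 'M[R]_(m, n), opnorm K <= L /\ stable L alpha (A - B *m K).

Definition detectable (R : realType) (L alpha : R) (n m : nat)
    (A : 'M[R]_n) (C : 'M[R]_(m, n)) : Prop :=
  stabilizable L alpha A^T C^T.

Definition subexponential (R : realType) (p : nat -> R) : Prop :=
  (forall d, 0 <= p d) /\
  forall r : R, 0 < r < 1 -> (fun d : nat => p d * r ^+ d) @ \oo --> (0 : R).

(* Discrete-time algebraic Riccati equation; the optimal LQR gain K* is
   [lqr_gain A B Rc P] for P the positive semidefinite solution of [dare]. *)
Definition dare (R : realType) (n m : nat) (A : 'M[R]_n) (B : 'M[R]_(n, m))
    (Q : 'M[R]_n) (Rc : 'M[R]_m) (P : 'M[R]_n) : Prop :=
  P = A^T *m P *m A
      - A^T *m P *m B *m invmx (Rc + B^T *m P *m B) *m B^T *m P *m A + Q.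

Definition lqr_gain (R : realType) (n m : nat) (A : 'M[R]_n) (B : 'M[R]_(n, m))
    (Rc : 'M[R]_m) (P : 'M[R]_n) : 'M[R]_(m, n) :=
  invmx (Rc + B^T *m P *m B) *m B^T *m P *m A.

Definition truncate (R : realType) (N : nat) (e : rel 'I_N) (m n : 'I_N -> nat)
    (kappa : nat) (K : 'M[R]_(\sum_i m i, \sum_j n j)) :
    'M[R]_(\sum_i m i, \sum_j n j) :=
  \mxblock_(i, j) (if gdist_le e i j kappa then submxblock K i j else 0).

Definition gammaF (R : realType) (L alpha : R) : R :=
  (1 - alpha) ^+ 2 / (L ^+ 2 * (1 + L) ^+ 2).

Definition gammaG (R : realType) (L alpha gamma : R) : R :=
  (1 - alpha) ^+ 2 * gamma / (2 * L ^+ 4 * (1 + L) ^+ 2).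

Definition LP (R : realType) (L alpha : R) : R :=
  L ^+ 3 * (1 + L ^+ 2) / (1 - alpha ^+ 2).

Definition LH (R : realType) (L alpha : R) : R :=
  Num.max (2 * L + 1) (LP L alpha + 1).

Definition mubar (R : realType) (L alpha gamma : R) : R :=
  let lH := LH L alpha in
  let gG := gammaG L alpha gamma in
  (2 * lH ^+ 2 / gG + gG + lH) / gammaF L alpha.

Definition gammaH (R : realType) (L alpha gamma : R) : R :=
  let lH := LH L alpha in
  let gG := gammaG L alpha gamma in
  let mu := mubar L alpha gamma in
  (2 / gG + (1 + 4 * lH / gG + 4 * lH ^+ 2 / gG ^+ 2)
            * (lH * (1 + mu * lH) / gammaF L alpha) + mu)^-1.

Definition rho (R : realType) (L alpha gamma : R) : R :=
  let lH := LH L alpha in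
  let gH := gammaH L alpha gamma in
  Num.sqrt ((lH ^+ 2 - gH ^+ 2) / (lH ^+ 2 + gH ^+ 2)).

Definition Upsilon (R : realType) (L alpha gamma : R) : R :=
  LH L alpha / (gammaH L alpha gamma ^+ 2 * rho L alpha gamma).

Definition delta (R : realType) (L alpha gamma : R) : R :=
  (rho L alpha gamma + 1) / 2.

Definition Psi (R : realType) (L alpha gamma : R) (p : nat -> R) : R :=
  let dl := delta L alpha gamma in
  sup (range (fun d : nat => p d * (rho L alpha gamma / dl) ^+ d))
  * (Upsilon L alpha gamma * dl / (1 - dl)).

Definition beta (R : realType) (L alpha gamma : R) : R :=
  Num.sqrt (1 - (1 - rho L alpha gamma ^+ 2) / (2 * Upsilon L alpha gamma ^+ 2)).

Definition Omega (R : realType) (L alpha gamma : R) : R :=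
  Num.sqrt (Upsilon L alpha gamma ^+ 2 / (1 - rho L alpha gamma ^+ 2)).

Definition kappabar (R : realType) (L alpha gamma : R) (p : nat -> R) : R :=
  let ps := Psi L alpha gamma p in
  1 / ln (delta L alpha gamma)
  * ln ((1 - rho L alpha gamma ^+ 2)
        / (2 * Upsilon L alpha gamma ^+ 2 * ps * L
           * (L * ps + 2 * L * (1 + LP L alpha * L ^+ 2 / gamma)))).

(* Main.v *)
From HB Require Import structures.
Require Import Defs.
From mathcomp Require Import ring lra zify.

Set Implicit Arguments.
Unset Strict Implicit.
Unset Printing Implicit Defensive.

Local Open Scope classical_set_scope.
Local Open Scope ring_scope.

(** For a horizon [T] with terminal cost [Pstar], the optimal trajectory
    [x_t = Phi^t x_0], [u_t = - Kstar x_t] together with the multipliers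
    [- Pstar x_t] solves a KKT system [H z = b] whose right-hand side lives at
    time 0. Stabilizability gives a right inverse of the dynamics (constant
    [gammaF]) and detectability gives coercivity of the cost on trajectories
    from 0 (constant [gammaG]), so [gammaH |z| <= |H z| <= LH |z|]. Hence
    [I - c H^2], with [c = 2 / (LH^2 + gammaH^2)], contracts by [rho^2], and
    [(I - c H^2)^k z] differs from [z] by a polynomial in [H] of degree [2k - 1]
    applied to [b]. As [H] only couples neighbouring nodes at consecutive times
    (apart from time [T], which is taken far enough), [z] decays like
    [rho^distance] in space and in time: [|Phi^t| <= Upsilon rho^t] and
    [|Kstar_ij| <= Upsilon rho^d(i,j)]. Subexponential growth and a Schur test
    turn the latter into [|Kstar - K^kappa| <= Psi delta^kappa], and the Lyapunov
    function [sum_t |Phi^t x|^2] absorbs this perturbation. *)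

(** * Semi-inner products *)

(** The KKT operator [H] is a saddle-point operator, in general indefinite, so [I - c H] is a
    contraction for no [c]; the form of [H^2] lies between [gammaH^2] and [LH^2], and the step [c]
    balances these two ends. Squaring costs parity: at distance [d] only [d./2] factors [rho^2] are
    available, and the [rho] in the denominator of [Upsilon] pays for the power that may be lost.
    The terminal cost is dense and breaks sparsity at time [T]; as it is [Pstar] itself, the same
    trajectory solves the system for every [T], so [T] can be moved until nothing coupled there
    reaches the entry of interest. Trajectories are functions on all of [nat] while the forms see
    only the horizon, hence forms that may be degenerate. Norm bounds for self-adjoint operators
    come from their quadratic forms by polarisation, so no spectral theorem enters. The decay of
    [Kstar] in space is read off the control at time 0. *)

Record semi_inner (R : realType) (V : lmodType R) (d : V -> V -> R) : Prop :=
  SemiInner {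
    innerC : forall u v, d u v = d v u;
    innerP : forall a u v w, d (a *: u + v) w = a * d u w + d v w;
    inner_ge0 : forall v, 0 <= d v v }.

Definition snorm (R : realType) (V : lmodType R) (d : V -> V -> R) (v : V) : R :=
  Num.sqrt (d v v).

Section SemiInner.
Variables (R : realType) (V : lmodType R) (d : V -> V -> R).
Hypothesis dP : semi_inner d.
Local Notation "`[ v ]" := (snorm d v) (format "`[ v ]").

Lemma innerDl u v w : d (u + v) w = d u w + d v w.
Proof. by rewrite -{1}[u]scale1r innerP ?mul1r. Qed.

Lemma inner0l w : d 0 w = 0.
Proof. by apply: (addrI (d 0 w)); rewrite -innerDl !addr0. Qed.

Lemma innerZl a u w : d (a *: u) w = a * d u w.
Proof. by rewrite -[a *: u]addr0 innerP // inner0l addr0. Qed.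

Lemma innerNl u w : d (- u) w = - d u w.
Proof. by rewrite -scaleN1r innerZl mulN1r. Qed.

Lemma innerBl u v w : d (u - v) w = d u w - d v w.
Proof. by rewrite innerDl innerNl. Qed.

Lemma innerDr u v w : d w (u + v) = d w u + d w v.
Proof. by rewrite innerC // innerDl !(innerC dP _ w). Qed.

Lemma inner0r w : d w 0 = 0.
Proof. by rewrite innerC // inner0l. Qed.

Lemma innerZr a u w : d w (a *: u) = a * d w u.
Proof. by rewrite innerC // innerZl (innerC dP _ w). Qed.

Lemma innerNr u w : d w (- u) = - d w u.
Proof. by rewrite innerC // innerNl (innerC dP _ w). Qed.

Lemma innerBr u v w : d w (u - v) = d w u - d w v.
Proof. by rewrite innerDr innerNr. Qed.

Lemma snorm_ge0 v : 0 <= `[v].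
Proof. exact: sqrtr_ge0. Qed.

Lemma sqr_snorm v : `[v] ^+ 2 = d v v.
Proof. by rewrite sqr_sqrtr // inner_ge0. Qed.

Lemma snorm0 : `[0] = 0.
Proof. by rewrite /snorm inner0l sqrtr0. Qed.

Lemma snormN v : `[- v] = `[v].
Proof. by rewrite /snorm innerNl innerNr opprK. Qed.

Lemma snormZ a v : `[a *: v] = `|a| * `[v].
Proof.
rewrite /snorm innerZl innerZr mulrA -expr2 sqrtrM ?sqr_ge0 //.
by rewrite sqrtr_sqr.
Qed.

(** Cauchy-Schwarz, with a separate case for a null vector [v]: there the quadratic in [s] is
    affine, and nonnegativity forces the cross term to vanish. *)
Lemma sqr_inner_le u v : d u v ^+ 2 <= d u u * d v v.
Proof.
have quad s : 0 <= d u u + 2 * s * d u v + s ^+ 2 * d v v.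
  have := inner_ge0 dP (u + s *: v).
  by rewrite innerDl !innerDr !innerZl !innerZr (innerC dP v u); lra.
have := inner_ge0 dP v; rewrite le_eqVlt => /orP[/eqP v0|v_gt0].
  rewrite -v0 mulr0; case: (eqVneq (d u v) 0) => [->|uv0]; first by rewrite expr0n.
  (* This [s] gives the affine function the value -1. *)
  have := quad (- (d u u + 1) / (2 * d u v)); rewrite -v0 mulr0 addr0.
  have -> : 2 * (- (d u u + 1) / (2 * d u v)) * d u v = - (d u u + 1) by field.
  by lra.
have := quad (- d u v / d v v).
have -> : d u u + 2 * (- d u v / d v v) * d u v + (- d u v / d v v) ^+ 2 * d v v
   = (d u u * d v v - d u v ^+ 2) / d v v by field; rewrite gt_eqF.
by rewrite pmulr_lge0 ?invr_gt0 // subr_ge0.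
Qed.

Lemma inner_le u v : d u v <= `[u] * `[v].
Proof.
apply: (le_trans (ler_norm _)).
rewrite /snorm -sqrtrM ?inner_ge0 // -sqrtr_sqr.
by rewrite ler_wsqrtr // sqr_inner_le.
Qed.

Lemma snormD u v : `[u + v] <= `[u] + `[v].
Proof.
rewrite -(ler_pXn2r (_ : 0 < 2)%N) ?nnegrE ?addr_ge0 ?snorm_ge0 //.
rewrite sqr_snorm innerDl !innerDr (innerC dP v u) sqrrD !sqr_snorm.
by have := inner_le u v; lra.
Qed.

Lemma snormB u v : `[u - v] <= `[u] + `[v].
Proof. by rewrite -(snormN v) snormD. Qed.

(* Testing against [y = w / c] turns the bilinear estimate into a norm bound. *)
Lemma snorm_dual c b w : 0 < c -> 0 <= b ->
  (forall y, d y w <= c * (d y y + b ^+ 2) / 2) -> `[w] <= c * b.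
Proof.
move=> c0 b0 /(_ (c^-1 *: w)); rewrite !innerZl !innerZr => h.
rewrite -(ler_pXn2r (_ : 0 < 2)%N) ?nnegrE ?mulr_ge0 ?snorm_ge0 ?(ltW c0) //.
rewrite exprMn sqr_snorm; set t := c^-1 * d w w in h.
have -> : d w w = c * t by rewrite /t mulVKf // gt_eqF.
rewrite (expr2 c) -mulrA ler_pM2l //.
by move: h; rewrite mulrDr mulVKf ?gt_eqF //; lra.
Qed.

(** Polarisation: subtracting the forms of [f] at [y + v] and [y - v] leaves four times the cross
    term, and the parallelogram law turns the two bounds into the hypothesis of [snorm_dual]. *)
Lemma snorm_selfadjoint (f : V -> V) c : 0 < c -> linear f ->
  (forall u v, d (f u) v = d u (f v)) ->
  (forall v, `|d (f v) v| <= c * d v v) -> forall v, `[f v] <= c * `[v].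
Proof.
move=> c0 flin fsa fle v; apply: snorm_dual (snorm_ge0 _) _ => // y.
rewrite sqr_snorm.
have fD a b : f (a + b) = f a + f b by rewrite -{1}[a]scale1r flin scale1r.
have fB a b : f (a - b) = f a - f b.
  by rewrite addrC -scaleN1r flin scaleN1r addrC.
have hp := fle (y + v); have hm := fle (y - v).
move: hp hm; rewrite !ler_norml fD fB !innerDl !innerDr !innerNl !innerNr.
rewrite (innerC dP v y) !fsa (innerC dP v (f y)) fsa.
by move=> /andP[_ h1] /andP[h2 _]; lra.
Qed.

End SemiInner.

(** * Forms on pairs and on finite stretches of a trajectory *)

Definition inner_pair (R : realType) (V W : lmodType R)
    (dV : V -> V -> R) (dW : W -> W -> R) (z z' : V * W) : R :=
  dV z.1 z'.1 + dW z.2 z'.2.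

Definition inner_sum (R : realType) (V : lmodType R) (d : V -> V -> R)
    (T : nat) (x y : nat -> V) : R :=
  \sum_(t < T) d (x t) (y t).

Section PairSum.
Variables (R : realType) (V W : lmodType R).
Variables (dV : V -> V -> R) (dW : W -> W -> R).
Hypotheses (dVP : semi_inner dV) (dWP : semi_inner dW).

Lemma semi_inner_pair : semi_inner (inner_pair dV dW).
Proof.
split=> [u v|a u v w|v]; rewrite /inner_pair.
- by rewrite (innerC dVP) (innerC dWP).
- by rewrite /= (innerP dVP) (innerP dWP) mulrDr addrACA.
- by rewrite addr_ge0 ?(inner_ge0 dVP) ?(inner_ge0 dWP).
Qed.

Lemma snorm_fst z : snorm dV z.1 <= snorm (inner_pair dV dW) z.
Proof. by rewrite ler_wsqrtr // lerDl (inner_ge0 dWP). Qed.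

Lemma snorm_snd z : snorm dW z.2 <= snorm (inner_pair dV dW) z.
Proof. by rewrite ler_wsqrtr // lerDr (inner_ge0 dVP). Qed.

Lemma snorm_pair z : snorm (inner_pair dV dW) z <= snorm dV z.1 + snorm dW z.2.
Proof.
rewrite -(ler_pXn2r (_ : 0 < 2)%N) ?nnegrE ?addr_ge0 ?snorm_ge0 //.
rewrite (sqr_snorm semi_inner_pair) sqrrD (sqr_snorm dVP) (sqr_snorm dWP).
rewrite /inner_pair addrAC lerDl.
by rewrite mulrn_wge0 // mulr_ge0 ?snorm_ge0.
Qed.

Lemma semi_inner_sum T : semi_inner (inner_sum dV T).
Proof.
split=> [u v|a u v w|v]; rewrite /inner_sum.
- by apply: eq_bigr => t _; rewrite (innerC dVP).
- by rewrite mulr_sumr -big_split /=; apply: eq_bigr => t _; rewrite (innerP dVP).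
- by apply: sumr_ge0 => t _; apply: (inner_ge0 dVP).
Qed.

Lemma snorm_coord T (x : nat -> V) t : (t < T)%N ->
  snorm dV (x t) <= snorm (inner_sum dV T) x.
Proof.
move=> tT; rewrite ler_wsqrtr // /inner_sum (bigD1 (Ordinal tT)) //= lerDl.
by apply: sumr_ge0 => i _; apply: (inner_ge0 dVP).
Qed.

End PairSum.

(** * Saddle-point operators and decay of inverses *)

Section SaddlePoint.
Variables (R : realType) (W U : lmodType R) (dW : W -> W -> R) (dU : U -> U -> R).
Hypotheses (dWP : semi_inner dW) (dUP : semi_inner dU).
Variables (G : {linear W -> W}) (F : {linear W -> U}) (Fa : {linear U -> W}).
Variables (f l g : R).
Hypotheses (f_ge0 : 0 <= f) (l_ge0 : 0 <= l) (g_gt0 : 0 < g).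
Hypothesis FaP : forall w u, dU (F w) u = dW w (Fa u).
Hypothesis G_le : forall w, snorm dW (G w) <= l * snorm dW w.
Hypothesis F_rinv : forall b, exists2 w, F w = b & snorm dW w <= f * snorm dU b.
Hypothesis G_ker : forall w, F w = 0 -> g * dW w w <= dW w (G w).

(** The KKT block operator with rows ([G], [Fa]) and ([F], 0): [G] is the Hessian of the cost, [F]
    the constraint and [Fa] its adjoint. *)
Definition saddle (z : W * U) : W * U := (G z.1 + Fa z.2, F z.1).

Lemma saddle_linear : linear saddle.
Proof.
move=> a u v; rewrite /saddle /= !linearP /=.
by congr pair; rewrite /= scalerDr addrACA.
Qed.

Lemma saddle_selfadjoint :
  (forall u v, dW (G u) v = dW u (G v)) -> forall z z',
  inner_pair dW dU (saddle z) z' = inner_pair dW dU z (saddle z').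
Proof.
move=> Gsa z z'; rewrite /inner_pair /= (innerDl dWP) (innerDr dWP) Gsa.
by rewrite (innerC dWP (Fa _)) -!FaP (innerC dUP z.2); ring.
Qed.

(* Split [w] into a preimage [w1] of [F w] and a kernel part, on which [G] is
   coercive; the multiplier is controlled by testing against a preimage of it. *)
Lemma saddle_lower z :
  snorm (inner_pair dW dU) z <=
  (g^-1 + 2 * (f * (1 + l / g)) + f ^+ 2 * l * (1 + l / g))
  * snorm (inner_pair dW dU) (saddle z).
Proof.
case: z => w u; set N := snorm _ (saddle _).
have N0 : 0 <= N by apply: snorm_ge0.
have aN : snorm dW (G w + Fa u) <= N by exact: (snorm_fst dW dUP (saddle (w, u))).
have bN : snorm dU (F w) <= N by exact: (snorm_snd dU dWP (saddle (w, u))).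
set a := G w + Fa u in aN *.
have [w1 Fw1 w1_le] := F_rinv (F w).
have {}w1_le : snorm dW w1 <= f * N by apply: (le_trans w1_le); rewrite ler_wpM2l.
have k0 : F (w - w1) = 0 by rewrite linearB /= Fw1 subrr.
have k_le : snorm dW (w - w1) <= (N + l * (f * N)) / g.
  have /= := G_ker k0.
  (* The multiplier term [Fa u] disappears because it is orthogonal to the kernel of [F]. *)
  have -> : dW (w - w1) (G (w - w1)) = dW (w - w1) (a - G w1).
    rewrite linearB /a /= addrAC [RHS](innerDr dWP) -FaP k0.
    by rewrite (inner0l dUP) addr0.
  rewrite -(sqr_snorm dWP) => h.
  rewrite ler_pdivlMr // mulrC.
  have := le_trans h (inner_le dWP _ _).
  have : snorm dW (a - G w1) <= N + l * (f * N).
    apply: le_trans (snormB dWP _ _) (lerD aN _).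
    by apply: le_trans (G_le _) _; rewrite ler_wpM2l.
  have := snorm_ge0 dW (w - w1); rewrite le_eqVlt => /orP[/eqP <- _ _|k_gt0 h1 h2].
    by rewrite mulr0 addr_ge0 // mulr_ge0 // mulr_ge0.
  rewrite -(ler_pM2r k_gt0) -mulrA -expr2; apply: le_trans h2 _.
  by rewrite mulrC ler_wpM2r // ltW.
have w_le : snorm dW w <= (g^-1 + f * (1 + l / g)) * N.
  have -> : w = w - w1 + w1 by rewrite subrK.
  apply: le_trans (snormD dWP _ _) _; apply: le_trans (lerD k_le w1_le) _.
  by rewrite le_eqVlt; apply/orP; left; apply/eqP; field; rewrite gt_eqF.
have u_le : snorm dU u <= f * (N + l * ((g^-1 + f * (1 + l / g)) * N)).
  have [w2 Fw2 w2_le] := F_rinv u.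
  have : dU u u = dW w2 (a - G w).
    by rewrite -{1}Fw2 FaP /a addrAC subrr add0r.
  rewrite -(sqr_snorm dUP) => h.
  have := inner_le dWP w2 (a - G w); rewrite -h.
  have : snorm dW (a - G w) <= N + l * ((g^-1 + f * (1 + l / g)) * N).
    apply: le_trans (snormB dWP _ _) (lerD aN _).
    by apply: le_trans (G_le _) _; rewrite ler_wpM2l.
  set M := N + _ => M_le.
  have M0 : 0 <= M by apply: le_trans M_le; apply: snorm_ge0.
  have := snorm_ge0 dU u; rewrite le_eqVlt => /orP[/eqP <- _|u_gt0 h2].
    by rewrite mulr_ge0.
  rewrite -(ler_pM2r u_gt0) -expr2; apply: le_trans h2 _.
  rewrite [leRHS]mulrAC; apply: ler_pM; rewrite ?snorm_ge0 //.
apply: le_trans (snorm_pair dWP dUP _) _; apply: le_trans (lerD w_le u_le) _.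
by rewrite le_eqVlt; apply/orP; left; apply/eqP; field; rewrite gt_eqF.
Qed.

End SaddlePoint.

(** * Approximating a solution by polynomials in the operator *)

Section InverseDecay.
Variables (R : realType) (V : lmodType R) (d : V -> V -> R).
Hypothesis dP : semi_inner d.
Variables (H : {linear V -> V}) (l g : R).
Hypotheses (g_gt0 : 0 < g) (gl : g < l).
Hypothesis Hsa : forall u v, d (H u) v = d u (H v).
Hypothesis H_le : forall v, snorm d (H v) <= l * snorm d v.
Hypothesis H_ge : forall v, g * snorm d v <= snorm d (H v).

Let c : R := 2 / (l ^+ 2 + g ^+ 2).
Let r : R := (l ^+ 2 - g ^+ 2) / (l ^+ 2 + g ^+ 2).
Let resid (v : V) : V := v - c *: H (H v).

(** With this [c] one has [1 - c g^2 = r] and [1 - c l^2 = - r], so the form of [I - c H^2] stays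
    within [r] in absolute value. *)
Lemma snorm_resid v : snorm d (resid v) <= r * snorm d v.
Proof.
have l_gt0 : 0 < l by apply: lt_trans gl.
have s_gt0 : 0 < l ^+ 2 + g ^+ 2 by rewrite addr_gt0 ?exprn_gt0.
apply: (snorm_selfadjoint dP) => {v} [|a u v|u v|v]; rewrite /resid.
- by rewrite divr_gt0 // subr_gt0 ltr_pXn2r ?nnegrE // ?(ltW l_gt0) ?(ltW g_gt0).
- by rewrite !linearP /= addrACA scalerDr.
- by rewrite (innerBl dP) (innerBr dP) (innerZl dP) (innerZr dP) !Hsa.
rewrite (innerBl dP) (innerZl dP) Hsa.
have le : d (H v) (H v) <= l ^+ 2 * d v v.
  rewrite -!(sqr_snorm dP) -exprMn ler_pXn2r ?nnegrE ?mulr_ge0 ?snorm_ge0 //.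
  exact: ltW.
have ge : g ^+ 2 * d v v <= d (H v) (H v).
  rewrite -!(sqr_snorm dP) -exprMn ler_pXn2r ?nnegrE ?mulr_ge0 ?snorm_ge0 //.
  exact: ltW.
have -> : d v v - c * d (H v) (H v) =
  ((l ^+ 2 + g ^+ 2) * d v v - 2 * d (H v) (H v)) / (l ^+ 2 + g ^+ 2).
  by rewrite /c; field; rewrite gt_eqF.
rewrite normrM (gtr0_norm (x := _^-1)) ?invr_gt0 // /r mulrAC.
by rewrite ler_pM2r ?invr_gt0 // ler_norml; lra.
Qed.

(** An abstract filtration that each use of [H] climbs by one step. It later consists of the vectors
    supported within a given space-time radius, so locality is separated from the norm estimates. *)
Variable S : nat -> V -> Prop.
Hypothesis S0 : forall m, S m 0.
Hypothesis SP : forall m a u v, S m u -> S m v -> S m (a *: u + v).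
Hypothesis S_mono : forall m u, S m u -> S m.+1 u.
Hypothesis S_H : forall m u, S m u -> S m.+1 (H u).

(* The approximant is a polynomial in [H] of degree [2k - 1] applied to [H z]:
   the truncated Neumann series of [H^-1 = H (H^2)^-1]. *)
Lemma inverse_decay z k : S 0 (H z) ->
  exists2 y, S k.*2.-1 y & snorm d (z - y) <= r ^+ k * snorm d z.
Proof.
have l_gt0 : 0 < l by apply: lt_trans gl.
have r_ge0 : 0 <= r.
  have [g0 l0] := (ltW g_gt0, ltW l_gt0).
  rewrite divr_ge0 //; last by rewrite addr_ge0 ?exprn_ge0.
  by rewrite subr_ge0 ler_pXn2r ?nnegrE ?(ltW gl).
move=> Sb; exists (z - iter k resid z); last first.
  rewrite opprB addrC subrK; elim: k => [|k IH]; first by rewrite mul1r.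
  rewrite iterS exprS -mulrA; apply: le_trans (snorm_resid _) _.
  by rewrite ler_wpM2l.
have SD m u v : S m u -> S m v -> S m (u + v).
  by move=> Su Sv; rewrite -(scale1r u); apply: SP.
have SZ m a u : S m u -> S m (a *: u).
  by move=> Su; rewrite -(addr0 (_ *: _)); apply: SP.
have SB m u v : S m u -> S m v -> S m (u - v).
  by move=> Su Sv; rewrite -scaleN1r addrC; apply: SP.
have S1 m : S m.+1 (H (H z)).
  by elim: m => [|m IH]; [apply: S_H | apply: S_mono].
elim: k => [|k IH]; first by rewrite subrr.
(* The approximants obey an affine recursion: [resid] climbs two levels, and the source [H (H z)]
   sits at level 1 only because [H z] is at level 0. *)
have -> : z - iter k.+1 resid z = resid (z - iter k resid z) + c *: H (H z).
  by rewrite iterS /resid !linearB /= !opprK !addrA [RHS]addrAC subrK.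
rewrite /= ; apply: SD; last exact/SZ/S1.
(* The zeroth approximant is 0, so the next one needs level 1 only; two general climbs from level 0
   would end at 2. *)
case: k IH => [|k] IH.
  by rewrite subrr /resid !linear0 addr0.
apply: SB; first exact/S_mono/S_mono.
by apply/SZ; apply/S_H/S_H.
Qed.

End InverseDecay.

(** * Euclidean vectors and the operator norm *)

Definition dotv (R : realType) (n : nat) (u v : 'cV[R]_n) : R := (u^T *m v) 0 0.

Section Euclidean.
Variable R : realType.

Lemma dotvE n (u v : 'cV[R]_n) : dotv u v = \sum_i u i 0 * v i 0.
Proof. by rewrite /dotv !mxE; apply: eq_bigr => i _; rewrite !mxE. Qed.

Lemma dotvP n : semi_inner (@dotv R n).
Proof.
split=> [u v|a u v w|v]; rewrite !dotvE.
- by apply: eq_bigr => i _; rewrite mulrC.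
- rewrite mulr_sumr -big_split; apply: eq_bigr => i _.
  by rewrite !mxE mulrDl mulrA.
- by apply: sumr_ge0 => i _; rewrite -expr2 sqr_ge0.
Qed.

Lemma norm2E n (v : 'cV[R]_n) : norm2 v = snorm (@dotv R n) v.
Proof. by rewrite /norm2 /snorm dotvE; congr Num.sqrt; apply: eq_bigr => i _; rewrite expr2. Qed.

Lemma norm2_ge0 n (v : 'cV[R]_n) : 0 <= norm2 v.
Proof. exact: sqrtr_ge0. Qed.

Lemma sqr_norm2 n (v : 'cV[R]_n) : norm2 v ^+ 2 = dotv v v.
Proof. by rewrite norm2E (sqr_snorm (dotvP n)). Qed.

Lemma norm2D n (u v : 'cV[R]_n) : norm2 (u + v) <= norm2 u + norm2 v.
Proof. by rewrite !norm2E (snormD (dotvP n)). Qed.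

Lemma norm2Z n a (v : 'cV[R]_n) : norm2 (a *: v) = `|a| * norm2 v.
Proof. by rewrite !norm2E (snormZ (dotvP n)). Qed.

Lemma dotv_le n (u v : 'cV[R]_n) : dotv u v <= norm2 u * norm2 v.
Proof. by rewrite !norm2E (inner_le (dotvP n)). Qed.

Lemma dotv_mull m n (M : 'M[R]_(m, n)) u v : dotv (M *m u) v = dotv u (M^T *m v).
Proof. by rewrite /dotv trmx_mul mulmxA. Qed.

Lemma norm2_eq0 n (v : 'cV[R]_n) : norm2 v = 0 -> v = 0.
Proof.
move=> v0; have := sqr_norm2 v; rewrite v0 expr0n dotvE /= => /esym/eqP.
rewrite psumr_eq0 => [/allP h|i _]; last by rewrite -expr2 sqr_ge0.
apply/matrixP => i j; rewrite (ord1 j) mxE; have := h i (mem_index_enum _).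
by rewrite /= mulf_eq0 orbb => /eqP.
Qed.

(** The Frobenius norm is a crude bound, needed to know that the supremum defining [opnorm] is over
    a bounded set. *)
Lemma norm2_mulmx_bounded m n (M : 'M[R]_(m, n)) :
  exists c, forall v, norm2 (M *m v) <= c * norm2 v.
Proof.
pose s := \sum_i norm2 (row i M)^T ^+ 2.
have s0 : 0 <= s by apply: sumr_ge0 => i _; rewrite sqr_ge0.
exists (Num.sqrt s) => v; rewrite -(ler_pXn2r (_ : 0 < 2)%N) ?nnegrE
  ?mulr_ge0 ?norm2_ge0 ?sqrtr_ge0 //.
rewrite exprMn (sqr_sqrtr s0) sqr_norm2 dotvE mulr_suml; apply: ler_sum => i _.
have -> : (M *m v) i 0 = dotv (row i M)^T v.
  by rewrite /dotv trmxK -row_mul [RHS]mxE.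
by rewrite -expr2 !sqr_norm2 (sqr_inner_le (dotvP n)).
Qed.

Let unit_image m n (M : 'M[R]_(m, n)) :=
  [set norm2 (M *m v) | v in [set v : 'cV[R]_n | norm2 v <= 1]].

Lemma opnorm_has_sup m n (M : 'M[R]_(m, n)) : has_sup (unit_image M).
Proof.
split.
  exists (norm2 (M *m 0)), 0 => //=.
  by rewrite norm2E (snorm0 (dotvP n)) ler01.
have [c c_le] := norm2_mulmx_bounded M; exists (Num.max c 0) => _ [v /= v1 <-].
have c_max : c <= Num.max c 0 by rewrite le_max lexx.
apply: le_trans (c_le v) _; apply: le_trans (ler_wpM2r (norm2_ge0 v) c_max) _.
by rewrite ler_piMr // le_max lexx orbT.
Qed.

Lemma norm2_mulmx_le m n (M : 'M[R]_(m, n)) v :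
  norm2 (M *m v) <= opnorm M * norm2 v.
Proof.
have [v0|v_neq0] := eqVneq (norm2 v) 0.
  by rewrite v0 mulr0 (norm2_eq0 v0) mulmx0 norm2E (snorm0 (dotvP m)).
have v_gt0 : 0 < norm2 v by rewrite lt_def v_neq0 norm2_ge0.
rewrite -ler_pdivrMr // mulrC.
have -> : (norm2 v)^-1 * norm2 (M *m v) = norm2 (M *m ((norm2 v)^-1 *: v)).
  by rewrite -scalemxAr norm2Z gtr0_norm // invr_gt0.
apply: sup_upper_bound; first exact: opnorm_has_sup.
exists ((norm2 v)^-1 *: v) => //=.
by rewrite norm2Z gtr0_norm ?invr_gt0 // mulVf.
Qed.

Lemma opnorm_le m n (M : 'M[R]_(m, n)) c : 0 <= c ->
  (forall v, norm2 (M *m v) <= c * norm2 v) -> opnorm M <= c.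
Proof.
move=> c0 c_le; apply: ge_sup; first by case: (opnorm_has_sup M).
move=> _ [v /= v1 <-]; apply: le_trans (c_le v) _.
by rewrite ler_piMr.
Qed.

Lemma norm2_mulmx m n (M : 'M[R]_(m, n)) c v : opnorm M <= c ->
  norm2 (M *m v) <= c * norm2 v.
Proof.
by move=> M_le; apply: le_trans (norm2_mulmx_le _ _) _; rewrite ler_wpM2r ?norm2_ge0.
Qed.

(** With [w = M^T v], the square of the norm of [w] is the product of [v] with [M w]; dividing by
    the norm of [w] gives the bound. It carries detectability, stated for transposes, back to
    [A]. *)
Lemma norm2_trmx m n (M : 'M[R]_(m, n)) c : 0 <= c ->
  (forall v, norm2 (M *m v) <= c * norm2 v) ->
  forall v, norm2 (M^T *m v) <= c * norm2 v.
Proof.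
move=> c0 M_le v; have := norm2_ge0 (M^T *m v); rewrite le_eqVlt.
case/orP=> [/eqP<-|w_gt0]; first by rewrite mulr_ge0 ?norm2_ge0.
rewrite -(ler_pM2l w_gt0) -expr2 sqr_norm2 -{1}[M]trmxK -dotv_mull trmxK.
apply: le_trans (dotv_le _ _) _.
apply: le_trans (ler_wpM2r (norm2_ge0 _) (M_le _)) _.
by rewrite mulrCA mulrA.
Qed.

Lemma norm2_quad m n (M : 'M[R]_(m, n)) c u v : 0 <= c ->
  (forall v, norm2 (M *m v) <= c * norm2 v) ->
  `|2 * dotv u (M *m v)| <= c * (dotv u u + dotv v v).
Proof.
move=> c0 M_le.
have h w : norm2 w <= c * norm2 v -> 2 * dotv u w <= c * (dotv u u + dotv v v).
  move=> w_le; apply: (@le_trans _ _ (2 * (norm2 u * (c * norm2 v)))).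
    rewrite ler_pM2l //; apply: le_trans (dotv_le _ _) _.
    by rewrite ler_wpM2l ?norm2_ge0.
  rewrite -!sqr_norm2 -subr_ge0.
  have -> : c * (norm2 u ^+ 2 + norm2 v ^+ 2) - 2 * (norm2 u * (c * norm2 v)) =
    c * (norm2 u - norm2 v) ^+ 2 by ring.
  by rewrite mulr_ge0 ?sqr_ge0.
rewrite ler_norml h // andbT lerNl -mulrN -(innerNr (dotvP m)) h //.
by rewrite norm2E (snormN (dotvP m)) -norm2E.
Qed.

Lemma expmxS n (M : 'M[R]_n) t : M ^+ t.+1 = M *m M ^+ t.
Proof. by rewrite exprS. Qed.

Lemma expmxSr n (M : 'M[R]_n) t : M ^+ t.+1 = M ^+ t *m M.
Proof. by rewrite exprSr. Qed.

Lemma expmx_tr n (M : 'M[R]_n) t : (M^T) ^+ t = (M ^+ t)^T.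
Proof.
by elim: t => [|t IH]; rewrite ?expr0 ?trmx1 // expmxS IH expmxSr trmx_mul.
Qed.

End Euclidean.

Arguments dotvP {R} n.

(** * Response of a stable system in the sum of squares *)

Section Convolution.
Variables (R : realType) (L alpha : R).
Hypotheses (L0 : 0 <= L) (alpha0 : 0 <= alpha) (alpha1 : alpha < 1).

(** The case of Young's convolution inequality for a geometric kernel. Writing [a t.+1] as the
    convex combination of [a t] and [b t.+1 / (1 - alpha)], convexity of the square gives one step;
    the sum of squares of [a] is then absorbed on the left. *)
Lemma sum_sqr_ar1 (a b : nat -> R) T :
  a 0%N = b 0%N -> (forall t, a t.+1 = alpha * a t + b t.+1) ->
  \sum_(t < T) a t ^+ 2 <= (1 - alpha)^-1 ^+ 2 * \sum_(t < T) b t ^+ 2.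
Proof.
move=> a0 aS; have s_gt0 : 0 < 1 - alpha by rewrite subr_gt0.
have step t : a t.+1 ^+ 2 <= alpha * a t ^+ 2 + (1 - alpha)^-1 * b t.+1 ^+ 2.
  rewrite -subr_ge0 aS; set x := a t; set y := b _.
  have -> : alpha * x ^+ 2 + (1 - alpha)^-1 * y ^+ 2 - (alpha * x + y) ^+ 2 =
    alpha * (1 - alpha) * (x - y / (1 - alpha)) ^+ 2 by field; rewrite gt_eqF.
  by rewrite mulr_ge0 ?sqr_ge0 // mulr_ge0 // ltW.
have s1 : 1 <= (1 - alpha)^-1 by rewrite invf_ge1 // gerBl.
case: T => [|T]; first by rewrite !big_ord0 mulr0.
have h : \sum_(t < T.+1) a t ^+ 2 <=
    alpha * (\sum_(t < T) a t ^+ 2) + (1 - alpha)^-1 * \sum_(t < T.+1) b t ^+ 2.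
  rewrite !big_ord_recl /= a0 mulrDr addrCA; apply: lerD.
    by rewrite ler_peMl ?sqr_ge0.
  by rewrite !mulr_sumr -big_split; apply: ler_sum => t _; apply: step.
rewrite -(ler_pM2l s_gt0) expr2 mulrA mulVKf ?gt_eqF //.
have : alpha * (\sum_(t < T) a t ^+ 2) <= alpha * (\sum_(t < T.+1) a t ^+ 2).
  by rewrite ler_wpM2l // big_ord_recr /= lerDl sqr_ge0.
by move: h; lra.
Qed.

Lemma stable_convolution n (Phi : 'M[R]_n) (y b : nat -> 'cV[R]_n) T :
  (forall t v, norm2 (Phi ^+ t *m v) <= L * alpha ^+ t * norm2 v) ->
  y 0%N = b 0%N -> (forall t, y t.+1 = Phi *m y t + b t.+1) ->
  snorm (inner_sum (@dotv R n) T) y <=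
  L / (1 - alpha) * snorm (inner_sum (@dotv R n) T) b.
Proof.
move=> Phi_le y0 yS.
(* The scalar majorant: the norms of [b] convolved with the powers of [alpha]. *)
pose a := fix a t := if t is t'.+1 then alpha * a t' + norm2 (b t) else norm2 (b 0%N).
have s_gt0 : 0 < 1 - alpha by rewrite subr_gt0.
have a_ge0 t : 0 <= a t.
  by elim: t => [|t IH] /=; rewrite ?norm2_ge0 // addr_ge0 ?norm2_ge0 // mulr_ge0.
(* The extra power of [Phi] lets the induction pay the factor [L] once for each input instead of
   once per time step. *)
have y_le k t : norm2 (Phi ^+ k *m y t) <= L * alpha ^+ k * a t.
  elim: t k => [|t IH] k; first by rewrite y0 Phi_le.
  rewrite yS mulmxDr mulmxA -expmxSr; apply: le_trans (norm2D _ _) _.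
  apply: le_trans (lerD (IH _) (Phi_le _ _)) _.
  by rewrite exprSr /=; lra.
rewrite -(ler_pXn2r (_ : 0 < 2)%N) ?nnegrE ?mulr_ge0 ?snorm_ge0 ?invr_ge0 ?(ltW s_gt0) //.
rewrite !exprMn !(sqr_snorm (semi_inner_sum (dotvP n) T)).
have -> : inner_sum (@dotv R n) T b b = \sum_(t < T) norm2 (b t) ^+ 2.
  by apply: eq_bigr => t _; rewrite sqr_norm2.
rewrite -mulrA; apply: (@le_trans _ _ (L ^+ 2 * \sum_(t < T) a t ^+ 2)).
  rewrite mulr_sumr; apply: ler_sum => t _; rewrite -sqr_norm2 -exprMn.
  rewrite ler_pXn2r ?nnegrE ?mulr_ge0 ?norm2_ge0 //.
  by have := y_le 0%N t; rewrite expr0 mul1mx mulr1.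
rewrite ler_wpM2l ?sqr_ge0 //.
exact: (@sum_sqr_ar1 a (fun t => norm2 (b t)) T).
Qed.

End Convolution.

(** * The Riccati equation *)

Lemma le_of_geometric (R : realType) (a b c r : R) : 0 <= r -> r < 1 ->
  (forall T : nat, a <= b + c * r ^+ T) -> a <= b.
Proof.
move=> r0 r1 h.
have cv : b + c * r ^+ T @[T --> \oo] --> b + c * 0.
  apply: cvgD; first exact: cvg_cst.
  apply: cvgMr; apply: cvg_expr.
  by rewrite ger0_norm.
rewrite -(addr0 b) -(mulr0 c) -(cvg_lim _ cv) //.
apply: limr_ge; first exact: cvgP cv.
by near=> T.
Unshelve. all: by end_near.
Qed.

Lemma psdmx_ge0 (R : realType) n (M : 'M[R]_n) v : psdmx M -> 0 <= dotv v (M *m v).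
Proof. by case=> _ /(_ v); rewrite /dotv mulmxA. Qed.

Lemma dotv_sym (R : realType) n (M : 'M[R]_n) u v : M^T = M ->
  dotv u (M *m v) = dotv v (M *m u).
Proof. by move=> Ms; rewrite (innerC (dotvP n)) dotv_mull Ms. Qed.

Section Riccati.
Variables (R : realType) (n m : nat) (L alpha gamma : R).
Variables (A : 'M[R]_n) (B : 'M[R]_(n, m)) (Q : 'M[R]_n) (Rc : 'M[R]_m).
Variables (P : 'M[R]_n) (Kb : 'M[R]_(m, n)).
Hypotheses (L0 : 0 <= L) (alpha0 : 0 <= alpha) (alpha1 : alpha < 1).
Hypothesis gamma_gt0 : 0 < gamma.
Hypotheses (A_le : forall v, norm2 (A *m v) <= L * norm2 v).
Hypotheses (B_le : forall v, norm2 (B *m v) <= L * norm2 v).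
Hypotheses (Q_le : forall v, norm2 (Q *m v) <= L * norm2 v).
Hypotheses (R_le : forall v, norm2 (Rc *m v) <= L * norm2 v).
Hypotheses (R_sym : Rc^T = Rc).
Hypothesis R_ge : forall v, gamma * dotv v v <= dotv v (Rc *m v).
Hypotheses (P_psd : psdmx P) (P_dare : dare A B Q Rc P).
Hypothesis Kb_le : forall v, norm2 (Kb *m v) <= L * norm2 v.
Hypothesis Kb_stable : forall t v,
  norm2 ((A - B *m Kb) ^+ t *m v) <= L * alpha ^+ t * norm2 v.

Local Notation K := (lqr_gain A B Rc P).
Local Notation Phi := (A - B *m K).
Let S := Rc + B^T *m P *m B.

Lemma lqr_hessian_ge v : gamma * dotv v v <= dotv v (S *m v).
Proof.
rewrite mulmxDl (innerDr (dotvP m)) -[leLHS]addr0; apply: lerD => //.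
by rewrite -!mulmxA -dotv_mull psdmx_ge0.
Qed.

Lemma lqr_hessian_unit : S \in unitmx.
Proof.
rewrite -unitmx_tr unitmxE unitfE; apply/det0P => -[v v_neq0 vS].
case/eqP: v_neq0; apply/trmx_inj; rewrite trmx0; apply: norm2_eq0; apply/eqP.
have := lqr_hessian_ge v^T; rewrite -[S]trmxK -trmx_mul vS trmx0 (inner0r (dotvP m)).
rewrite -sqr_norm2 pmulr_rle0 // => h.
by rewrite -sqrf_eq0 eq_le h sqr_ge0.
Qed.

Lemma mul_hessian_gain : S *m K = B^T *m P *m A.
Proof. by rewrite /lqr_gain -/S -!mulmxA mulKVmx ?lqr_hessian_unit. Qed.

(** Together with [gain_stationary], this removes the inverse from the Riccati equation: they are
    the state row and the control row of the KKT system with multiplier [- P x]. *)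
Lemma riccati_closed_loop : P = Q + A^T *m P *m Phi.
Proof.
rewrite {1}P_dare addrC; congr (_ + _).
by rewrite mulmxBr /lqr_gain !mulmxA.
Qed.

Lemma gain_stationary : Rc *m K = B^T *m P *m Phi.
Proof.
have := mul_hessian_gain; rewrite /S mulmxDl mulmxBr => <-.
by rewrite !mulmxA addrK.
Qed.

(** Bellman's inequality by completing the square: right minus left is the form of the Hessian [S]
    at the deviation [w = u + K x], the terms linear in [w] cancelling by [gain_stationary]. *)
Lemma riccati_step x u :
  dotv x (P *m x) <= dotv x (Q *m x) + dotv u (Rc *m u)
    + dotv (A *m x + B *m u) (P *m (A *m x + B *m u)).
Proof.
have dn := @dotvP R n; have dm := @dotvP R m.
have P_sym : P^T = P by case: P_psd.
pose p := Phi *m x; pose k := K *m x; pose w := u + k.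
have -> : A *m x + B *m u = p + B *m w.
  rewrite /p /w /k mulmxBl mulmxDr -mulmxA addrA.
  by rewrite [A *m x - _ + _]addrAC subrK.
have uE : u = w - k by rewrite /w addrK.
have Rk : Rc *m k = B^T *m P *m p.
  by rewrite /k /p mulmxA gain_stationary mulmxA.
have Bdot v : dotv (B *m v) (P *m p) = dotv v (Rc *m k).
  by rewrite Rk dotv_mull mulmxA.
have -> : dotv x (P *m x) = dotv x (Q *m x) + dotv p (P *m p) + dotv k (Rc *m k).
  rewrite {1}riccati_closed_loop mulmxDl (innerDr dn) -addrA; congr (_ + _).
  rewrite -!mulmxA -/p -dotv_mull.
  have -> : A *m x = p + B *m k by rewrite /p /k mulmxBl mulmxA subrK.
  by rewrite (innerDl dn) Bdot.
rewrite uE mulmxBr (innerBr dm) !(innerBl dm) (dotv_sym _ _ R_sym).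
rewrite mulmxDr (innerDr dn) !(innerDl dn) Bdot.
rewrite (dotv_sym p) // Bdot (dotv_sym k w R_sym).
have := psdmx_ge0 (B *m w) P_psd; have := R_ge w.
have : 0 <= gamma * dotv w w by rewrite mulr_ge0 ?(inner_ge0 dm) // ltW.
by lra.
Qed.

(** The form of [P] is at most the cost of any policy whose states tend to 0; here that policy is
    the stabilizing feedback [Kb]. *)
Lemma riccati_quad_le x : dotv x (P *m x) <= LP L alpha * dotv x x.
Proof.
have [c c_le] := norm2_mulmx_bounded P.
have x0 := sqr_ge0 (norm2 x).
have a2_ge0 : 0 <= alpha ^+ 2 by rewrite sqr_ge0.
have a2_lt1 : alpha ^+ 2 < 1 by rewrite expr_lt1.
pose X t := (A - B *m Kb) ^+ t *m x.
have XS t : X t.+1 = A *m X t + B *m (- (Kb *m X t)).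
  by rewrite /X expmxS -mulmxA mulmxBl -mulmxA mulmxN.
have Xle t : norm2 (X t) ^+ 2 <= L ^+ 2 * norm2 x ^+ 2 * (alpha ^+ 2) ^+ t.
  rewrite exprAC mulrAC -!exprMn ler_pXn2r ?nnegrE ?norm2_ge0 ?Kb_stable //.
  by rewrite !mulr_ge0 ?norm2_ge0 ?exprn_ge0.
have quad_le k (M : 'M[R]_k) l v : (forall v, norm2 (M *m v) <= l * norm2 v) ->
    dotv v (M *m v) <= l * norm2 v ^+ 2.
  move=> h; apply: le_trans (dotv_le _ _) _.
  by rewrite expr2 mulrCA ler_wpM2l ?norm2_ge0.
(* A stage costs at most [L (1 + L^2)] times the squared state, and the squared state at most
   [L^2 alpha^(2t)] times that of [x]; the geometric sum of the product is [LP]. *)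
pose q := L ^+ 3 * (1 + L ^+ 2) * norm2 x ^+ 2.
have step t : dotv (X t) (P *m X t) <=
    q * (alpha ^+ 2) ^+ t + dotv (X t.+1) (P *m X t.+1).
  apply: le_trans (riccati_step _ (- (Kb *m X t))) _; rewrite -XS lerD2r.
  rewrite mulmxN (innerNl (dotvP m)) (innerNr (dotvP m)) opprK.
  apply: le_trans (lerD (quad_le _ _ _ _ Q_le) (quad_le _ _ _ _ R_le)) _.
  have h : norm2 (Kb *m X t) ^+ 2 <= L ^+ 2 * norm2 (X t) ^+ 2.
    by rewrite -exprMn ler_pXn2r ?nnegrE ?mulr_ge0 ?norm2_ge0.
  apply: (@le_trans _ _ (L * (1 + L ^+ 2) * norm2 (X t) ^+ 2)).
    by rewrite -!mulrA -mulrDr ler_wpM2l // mulrDl mul1r lerD2l.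
  have -> : q * (alpha ^+ 2) ^+ t = L * (1 + L ^+ 2) *
     (L ^+ 2 * norm2 x ^+ 2 * (alpha ^+ 2) ^+ t) by rewrite /q; ring.
  by rewrite ler_wpM2l // mulr_ge0 // addr_ge0 ?sqr_ge0.
have q0 : 0 <= q.
  by rewrite /q mulr_ge0 // mulr_ge0 ?exprn_ge0 // addr_ge0 ?sqr_ge0.
have s_gt0 : 0 < 1 - alpha ^+ 2 by rewrite subr_gt0.
have iterate T : dotv x (P *m x) <= q / (1 - alpha ^+ 2) * (1 - (alpha ^+ 2) ^+ T)
    + dotv (X T) (P *m X T).
  elim: T => [|T IH]; first by rewrite /X !expr0 mul1mx subrr mulr0 add0r.
  apply: le_trans IH _; apply: le_trans (lerD (lexx _) (step T)) _.
  rewrite addrA lerD2r le_eqVlt; apply/orP; left; apply/eqP.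
  by rewrite (exprS _ T); field; rewrite gt_eqF.
have -> : LP L alpha * dotv x x = q / (1 - alpha ^+ 2).
  by rewrite /LP /q sqr_norm2 mulrAC.
(* The cost left after time [T] vanishes as [T] grows, so any bound [c] on [P], however poor, is
   enough for it. *)
apply: (@le_of_geometric _ _ _ (`|c| * (L ^+ 2 * norm2 x ^+ 2)) (alpha ^+ 2)) => // T.
apply: le_trans (iterate T) _; apply: lerD.
  rewrite ler_piMr ?divr_ge0 ?(ltW s_gt0) //.
  by rewrite gerBl exprn_ge0.
apply: (@le_trans _ _ (`|c| * norm2 (X T) ^+ 2)).
  apply: quad_le => v; apply: le_trans (c_le v) _.
  by rewrite ler_wpM2r ?norm2_ge0 // ler_norm.
by rewrite -[leRHS]mulrA ler_wpM2l.
Qed.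

Lemma LP_gt0 : 0 < L -> 0 < LP L alpha.
Proof.
move=> L_gt0; rewrite divr_gt0 //; last by rewrite subr_gt0 expr_lt1.
by rewrite mulr_gt0 ?exprn_gt0 // addr_gt0 ?exprn_gt0.
Qed.

Lemma riccati_norm_le x : 0 < L -> norm2 (P *m x) <= LP L alpha * norm2 x.
Proof.
move=> L_gt0; have [P_sym _] := P_psd; rewrite !norm2E.
apply: (@snorm_selfadjoint _ _ _ (dotvP n) (mulmx P)) => [||u v|v].
- exact: LP_gt0.
- exact: linearP.
- by rewrite dotv_mull P_sym.
- by rewrite (innerC (dotvP n)) ger0_norm ?psdmx_ge0 // riccati_quad_le.
Qed.

(** Coercivity of the Hessian at [K x], where its value is known from [mul_hessian_gain]; one factor
    of the norm of [K x] is cancelled. *)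
Lemma gain_norm_le x : 0 < L ->
  norm2 (K *m x) <= LP L alpha * L ^+ 2 / gamma * norm2 x.
Proof.
move=> L_gt0.
have c0 : 0 <= LP L alpha * L ^+ 2.
  by rewrite mulr_ge0 ?sqr_ge0 // ltW // LP_gt0.
have := norm2_ge0 (K *m x); rewrite le_eqVlt => /orP[/eqP <-|k_gt0].
  by rewrite mulr_ge0 ?norm2_ge0 // divr_ge0 // ltW.
rewrite -(ler_pM2l k_gt0) -expr2 sqr_norm2 -(ler_pM2l gamma_gt0).
apply: le_trans (lqr_hessian_ge _) _; rewrite mulmxA mul_hessian_gain.
apply: le_trans (dotv_le _ _) _.
have -> : gamma * (norm2 (K *m x) * (LP L alpha * L ^+ 2 / gamma * norm2 x)) =
  norm2 (K *m x) * (L * (LP L alpha * (L * norm2 x))).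
  by field; rewrite gt_eqF.
rewrite ler_pM2l // -!mulmxA.
apply: le_trans (norm2_trmx L0 B_le _) _; rewrite ler_wpM2l //.
apply: le_trans (riccati_norm_le _ L_gt0) _; rewrite ler_wpM2l // ltW //.
exact: LP_gt0.
Qed.

End Riccati.

(** * The KKT operator of the finite-horizon problem *)

Section KKT.
Variables (R : realType) (n m : nat) (A : 'M[R]_n) (B : 'M[R]_(n, m)).
Variables (Q : 'M[R]_n) (Rc : 'M[R]_m) (P : 'M[R]_n) (T : nat).

Local Notation traj k := (nat -> 'cV[R]_k).
Local Notation primal := (traj n * traj m)%type.

(* Horizon [T] with terminal cost [P]: the states and multipliers of interest
   are those at times [t <= T], the controls those at times [t < T]. *)
Definition dot_dual : traj n -> traj n -> R := inner_sum (@dotv R n) T.+1.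
Definition dot_primal : primal -> primal -> R :=
  inner_pair dot_dual (inner_sum (@dotv R m) T).
Definition dot_kkt : primal * traj n -> primal * traj n -> R :=
  inner_pair dot_primal dot_dual.

Lemma dot_dualP : semi_inner dot_dual.
Proof. by apply: semi_inner_sum; apply: dotvP. Qed.

Lemma dot_primalP : semi_inner dot_primal.
Proof. by apply: semi_inner_pair; [apply: dot_dualP | apply: semi_inner_sum; apply: dotvP]. Qed.

Lemma dot_kktP : semi_inner dot_kkt.
Proof. by apply: semi_inner_pair; [apply: dot_primalP | apply: dot_dualP]. Qed.

Definition cost_op (w : primal) : primal :=
  (fun t => (if (t < T)%N then Q else P) *m w.1 t,
   fun t => if (t < T)%N then Rc *m w.2 t else 0).

Definition dyn_op (w : primal) : traj n :=
  fun t => w.1 t - (if t is s.+1 then A *m w.1 s + B *m w.2 s else 0).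

Definition dyn_adj (l : traj n) : primal :=
  (fun t => l t - (if (t < T)%N then A^T *m l t.+1 else 0),
   fun t => if (t < T)%N then - (B^T *m l t.+1) else 0).

Lemma cost_op_linear : linear cost_op.
Proof.
move=> a u v; congr pair; apply/funext => t /=; first by rewrite linearP.
rewrite !(addrfctE, scalrfctE) /=; case: ifP => _; last by rewrite scaler0 addr0.
by rewrite linearP.
Qed.

Lemma dyn_op_linear : linear dyn_op.
Proof.
move=> a u v; apply/funext => -[|t]; rewrite /dyn_op !(addrfctE, scalrfctE) /=.
  by rewrite !subr0.
rewrite !linearP /= scalerBr scalerDr !opprD.
have -> : (a *: u.1 + v.1) t.+1 = a *: u.1 t.+1 + v.1 t.+1 by [].
by rewrite [RHS]addrACA; congr (_ + _); rewrite addrACA.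
Qed.

Lemma dyn_adj_linear : linear dyn_adj.
Proof.
move=> a u v; congr pair; apply/funext => t.
  change (a *: u t + v t - (if (t < T)%N then A^T *m (a *: u t.+1 + v t.+1) else 0)
    = a *: (u t - (if (t < T)%N then A^T *m u t.+1 else 0))
      + (v t - (if (t < T)%N then A^T *m v t.+1 else 0))).
  case: ifP => _; last by rewrite !subr0.
  by rewrite linearP /= scalerBr opprD addrACA.
change ((if (t < T)%N then - (B^T *m (a *: u t.+1 + v t.+1)) else 0)
  = a *: (if (t < T)%N then - (B^T *m u t.+1) else 0)
    + (if (t < T)%N then - (B^T *m v t.+1) else 0)).
case: ifP => _; last by rewrite scaler0 addr0.
by rewrite linearP /= opprD scalerN.
Qed.

HB.instance Definition _ := GRing.isLinear.Build R primal primal _ cost_op cost_op_linear.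
HB.instance Definition _ := GRing.isLinear.Build R primal (traj n) _ dyn_op dyn_op_linear.
HB.instance Definition _ := GRing.isLinear.Build R (traj n) primal _ dyn_adj dyn_adj_linear.

Definition kkt : primal * traj n -> primal * traj n :=
  saddle cost_op dyn_op dyn_adj.

HB.instance Definition _ := GRing.isLinear.Build R (primal * traj n)%type
  (primal * traj n)%type _ kkt (saddle_linear cost_op dyn_op dyn_adj).

(** Summation by parts: the time shift moves onto the multiplier. The initial constraint has no
    predecessor, and the cut of [dyn_adj] at [T] matches it at the other end. *)
Lemma dyn_adjP w l : dot_dual (dyn_op w) l = dot_primal w (dyn_adj l).
Proof.
have dn := @dotvP R n; have dm := @dotvP R m.
rewrite /dot_primal /inner_pair /dot_dual /inner_sum /=.
under eq_bigr do rewrite (innerBl dn).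
under [in RHS]eq_bigr do rewrite (innerBr dn).
rewrite !big_split /= -addrA; congr (_ + _).
rewrite big_ord_recl big_ord_recr /= ltnn (inner0l dn) (inner0r dn) oppr0 add0r addr0.
rewrite -big_split; apply: eq_bigr => t _ /=; rewrite /bump /= add1n ltn_ord.
by rewrite (innerDl dn) opprD (innerNr dm) !dotv_mull.
Qed.

Lemma kkt_selfadjoint z z' : Q^T = Q -> Rc^T = Rc -> P^T = P ->
  dot_kkt (kkt z) z' = dot_kkt z (kkt z').
Proof.
move=> Qs Rs Ps; apply: (saddle_selfadjoint dot_primalP dot_dualP dyn_adjP) => u v.
rewrite /dot_primal /inner_pair /dot_dual /inner_sum /=; congr (_ + _).
  by apply: eq_bigr => t _; rewrite dotv_mull; case: ifP => _; rewrite ?Qs ?Ps.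
by apply: eq_bigr => t _; rewrite ltn_ord dotv_mull Rs.
Qed.

End KKT.

Arguments dot_dualP {R n} T.
Arguments dot_primalP {R n m} T.
Arguments dot_kktP {R n m} T.

(** The hypotheses as pointwise norm bounds. Detectability appears as an output injection [D] for a
    factor [C] of [Q], the form in which it acts on trajectories. *)
Record lqr_problem (R : realType) (n m : nat) (L alpha gamma : R)
  (A : 'M[R]_n) (B : 'M[R]_(n, m)) (Q : 'M[R]_n) (Rc : 'M[R]_m) : Prop :=
  LqrProblem {
    lqr_L : 1 < L;
    lqr_alpha0 : 0 < alpha;
    lqr_alpha1 : alpha < 1;
    lqr_gamma0 : 0 < gamma;
    lqr_gamma1 : gamma < 1;
    lqr_A : forall v, norm2 (A *m v) <= L * norm2 v;
    lqr_B : forall v, norm2 (B *m v) <= L * norm2 v;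
    lqr_Q : forall v, norm2 (Q *m v) <= L * norm2 v;
    lqr_R : forall v, norm2 (Rc *m v) <= L * norm2 v;
    lqr_R_sym : Rc^T = Rc;
    lqr_R_ge : forall v, gamma * dotv v v <= dotv v (Rc *m v);
    lqr_stab : exists K : 'M[R]_(m, n), (forall v, norm2 (K *m v) <= L * norm2 v) /\
      forall t v, norm2 ((A - B *m K) ^+ t *m v) <= L * alpha ^+ t * norm2 v;
    lqr_detect : exists C D : 'M[R]_n, [/\ Q = C^T *m C,
      forall v, norm2 (D *m v) <= L * norm2 v &
      forall t v, norm2 ((A - D *m C) ^+ t *m v) <= L * alpha ^+ t * norm2 v] }.

(** * Boundedness and coercivity of the cost, right inverse of the dynamics *)

Section KKTBounds.
Variables (R : realType) (n m : nat) (L alpha gamma : R).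
Variables (A : 'M[R]_n) (B : 'M[R]_(n, m)) (Q : 'M[R]_n) (Rc : 'M[R]_m).
Hypothesis pb : lqr_problem L alpha gamma A B Q Rc.
Variable P : 'M[R]_n.
Hypotheses (P_psd : psdmx P)
  (P_le : forall v, norm2 (P *m v) <= LP L alpha * norm2 v).
Variable T : nat.

Let L_gt0 : 0 < L. Proof. exact: lt_trans ltr01 (lqr_L pb). Qed.
Let L_ge0 : 0 <= L. Proof. exact: ltW. Qed.
Let s_gt0 : 0 < 1 - alpha. Proof. by rewrite subr_gt0 (lqr_alpha1 pb). Qed.

Lemma lqr_Q_sym : Q^T = Q.
Proof. by have [C [D [-> _ _]]] := lqr_detect pb; rewrite trmx_mul trmxK. Qed.

Lemma LP_pos : 0 < LP L alpha.
Proof. by apply: LP_gt0 => //; [rewrite ltW ?(lqr_alpha0 pb)|exact: lqr_alpha1 pb]. Qed.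

Lemma LH_ge_L : 2 * L + 1 <= LH L alpha.
Proof. by rewrite le_max lexx. Qed.

Lemma LH_ge_LP : LP L alpha + 1 <= LH L alpha.
Proof. by rewrite le_max lexx orbT. Qed.

Lemma LH_ge3 : 3 <= LH L alpha.
Proof. by apply: le_trans LH_ge_L; have := lqr_L pb; lra. Qed.

Lemma cost_op_le w :
  snorm (dot_primal T) (cost_op Q Rc P T w) <= LH L alpha * snorm (dot_primal T) w.
Proof.
have LH0 : 0 <= LH L alpha by apply: le_trans LH_ge3; rewrite ler0n.
have hL : L <= LH L alpha by apply: le_trans LH_ge_L; have := L_gt0; lra.
have hP : LP L alpha <= LH L alpha by apply: le_trans LH_ge_LP; lra.
have sq k k' (M : 'M[R]_(k, k')) l v : l <= LH L alpha ->
    (forall v, norm2 (M *m v) <= l * norm2 v) ->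
    dotv (M *m v) (M *m v) <= LH L alpha ^+ 2 * dotv v v.
  move=> l_le M_le; rewrite -!sqr_norm2 -exprMn.
  rewrite ler_pXn2r ?nnegrE ?mulr_ge0 ?norm2_ge0 //.
  by apply: le_trans (M_le v) _; rewrite ler_wpM2r ?norm2_ge0.
rewrite -(ler_pXn2r (_ : 0 < 2)%N) ?nnegrE ?mulr_ge0 ?snorm_ge0 //.
rewrite exprMn !(sqr_snorm (dot_primalP T)).
rewrite /dot_primal /inner_pair /dot_dual /inner_sum /= mulrDr !mulr_sumr.
apply: lerD; apply: ler_sum => t _.
  by case: ifP => _; [apply: sq hL (lqr_Q pb) | apply: sq hP P_le].
by rewrite ltn_ord; apply: sq hL (lqr_R pb).
Qed.

Lemma dyn_op_rinv b : exists2 w, dyn_op A B w = b &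
  snorm (dot_primal T) w <= L * (1 + L) / (1 - alpha) * snorm (dot_dual T) b.
Proof.
have [K [K_le K_stab]] := lqr_stab pb.
(* The preimage of [b] is the closed loop of the stabilizing feedback driven by [b]; the input is at
   most [L] times the state, whence the factor [1 + L]. *)
pose x := fix x t := if t is s.+1 then (A - B *m K) *m x s + b t else b 0%N.
pose w : (nat -> 'cV[R]_n) * (nat -> 'cV[R]_m) := (x, fun t => - (K *m x t)).
exists w.
  apply/funext => -[|t]; rewrite /dyn_op /= ?subr0 //.
  by rewrite mulmxBl mulmxN mulmxA addrC addKr.
have x_le : snorm (dot_dual T) x <= L / (1 - alpha) * snorm (dot_dual T) b.
  by apply: (stable_convolution _ _ _ _ K_stab) => //;
    [rewrite ltW ?(lqr_alpha0 pb) | exact: lqr_alpha1 pb].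
apply: le_trans (snorm_pair (dot_dualP T) (semi_inner_sum (dotvP _) _) _) _.
have u_le : snorm (inner_sum (@dotv R m) T) w.2 <= L * snorm (dot_dual T) x.
  rewrite -(ler_pXn2r (_ : 0 < 2)%N) ?nnegrE ?mulr_ge0 ?snorm_ge0 //.
  rewrite exprMn (sqr_snorm (dot_dualP T)) (sqr_snorm (semi_inner_sum (dotvP _) _)).
  rewrite /dot_dual /inner_sum big_ord_recr mulrDr mulr_sumr /=.
  rewrite -[leLHS]addr0; apply: lerD; last by rewrite mulr_ge0 ?sqr_ge0 // (inner_ge0 (dotvP _)).
  apply: ler_sum => t _; rewrite -!sqr_norm2 -exprMn.
  rewrite ler_pXn2r ?nnegrE ?mulr_ge0 ?norm2_ge0 //.
  by rewrite norm2E (snormN (dotvP _)) -norm2E.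
apply: le_trans (lerD (lexx _) u_le) _ => /=.
have -> : L * (1 + L) / (1 - alpha) * snorm (dot_dual T) b =
  (1 + L) * (L / (1 - alpha) * snorm (dot_dual T) b) by field; rewrite gt_eqF.
apply: (@le_trans _ _ ((1 + L) * snorm (dot_dual T) x)); first by lra.
by rewrite ler_wpM2l // addr_ge0.
Qed.

(* Detectability: a trajectory from [0] is driven by [D C x + B u] through a
   stable system, hence controlled by the observations [C x] and the inputs. *)
Lemma cost_op_coercive w : dyn_op A B w = 0 ->
  gammaG L alpha gamma * dot_primal T w w <= dot_primal T w (cost_op Q Rc P T w).
Proof.
case: w => x u Fw.
have [C [D [QE D_le D_stab]]] := lqr_detect pb.
have x0 : x 0%N = 0.
  by have := congr1 (fun y => y 0%N) Fw; rewrite /dyn_op /= subr0.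
have xS t : x t.+1 = A *m x t + B *m u t.
  by have := congr1 (fun y => y t.+1) Fw; rewrite /dyn_op /= => /subr0_eq.
pose b t := if t is s.+1 then D *m (C *m x s) + B *m u s else 0.
have x_le : snorm (dot_dual T) x <= L / (1 - alpha) * snorm (dot_dual T) b.
  apply: (stable_convolution _ _ _ _ D_stab) => //;
    [by rewrite ltW ?(lqr_alpha0 pb) | exact: lqr_alpha1 pb | move=> t].
  by rewrite xS /b mulmxBl -mulmxA addrA subrK.
pose s := \sum_(t < T) (norm2 (C *m x t) ^+ 2 + norm2 (u t) ^+ 2).
have s0 : 0 <= s by apply: sumr_ge0 => t _; rewrite addr_ge0 ?sqr_ge0.
have b_le : dot_dual T b b <= 2 * L ^+ 2 * s.
  rewrite /dot_dual /inner_sum big_ord_recl /= (inner0l (dotvP _)) add0r mulr_sumr.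
  apply: ler_sum => t _ /=; rewrite -sqr_norm2.
  have := norm2D (D *m (C *m x t)) (B *m u t).
  have := D_le (C *m x t); have := lqr_B pb (u t).
  set p := norm2 (C *m x t); set q := norm2 (u t) => h1 h2 h3.
  have h4 : norm2 (D *m (C *m x t) + B *m u t) <= L * (p + q) by lra.
  apply: (@le_trans _ _ ((L * (p + q)) ^+ 2)).
    by rewrite ler_pXn2r ?nnegrE ?mulr_ge0 ?addr_ge0 ?norm2_ge0.
  rewrite -subr_ge0.
  have -> : 2 * L ^+ 2 * (p ^+ 2 + q ^+ 2) - (L * (p + q)) ^+ 2 =
    (L * (p - q)) ^+ 2 by ring.
  by rewrite sqr_ge0.
have {}x_le : dot_dual T x x <= (L / (1 - alpha)) ^+ 2 * (2 * L ^+ 2 * s).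
  rewrite -(sqr_snorm (dot_dualP T)).
  apply: (@le_trans _ _ ((L / (1 - alpha) * snorm (dot_dual T) b) ^+ 2)).
    by rewrite ler_pXn2r ?nnegrE ?mulr_ge0 ?invr_ge0 ?snorm_ge0 // ltW.
  by rewrite exprMn (sqr_snorm (dot_dualP T)) ler_wpM2l ?sqr_ge0.
have u_le : inner_sum (@dotv R m) T u u <= s.
  by apply: ler_sum => t _; rewrite -sqr_norm2 lerDr sqr_ge0.
have g0 := lqr_gamma0 pb; have g1 := lqr_gamma1 pb.
(* The terminal cost is dropped as nonnegative, and [gamma < 1] lets the state cost, whose
   coefficient is 1, share the factor of the input cost. *)
have cost_ge : gamma * s <= dot_primal T (x, u) (cost_op Q Rc P T (x, u)).
  rewrite /dot_primal /inner_pair /dot_dual /inner_sum /= big_ord_recr /= ltnn.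
  rewrite addrAC -[leLHS]addr0; apply: lerD; last exact: psdmx_ge0.
  rewrite -big_split /= mulr_sumr; apply: ler_sum => t _.
  rewrite ltn_ord mulrDr sqr_norm2 sqr_norm2; apply: lerD; last exact: lqr_R_ge pb _.
  rewrite QE -mulmxA -dotv_mull.
  by rewrite ler_piMl ?(inner_ge0 (dotvP _)) // ltW.
apply: le_trans cost_ge.
have gG0 : 0 <= gammaG L alpha gamma.
  apply: divr_ge0; apply: mulr_ge0; rewrite ?sqr_ge0 ?(ltW g0) //.
  by apply: mulr_ge0; rewrite ?exprn_ge0.
apply: (@le_trans _ _ (gammaG L alpha gamma *
    ((L / (1 - alpha)) ^+ 2 * (2 * L ^+ 2 * s) + s))).
  by rewrite ler_wpM2l //; apply: lerD.
have L1 := lqr_L pb.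
(* What remains is that the last factor is at most 1: its numerator is at most 2, below
   [(1 + L)^2]. *)
have -> : gammaG L alpha gamma * ((L / (1 - alpha)) ^+ 2 * (2 * L ^+ 2 * s) + s)
  = gamma * s * (((1 - alpha) ^+ 2 / (2 * L ^+ 4) + 1) / (1 + L) ^+ 2).
  rewrite /gammaG; field.
  by rewrite ?(gt_eqF s_gt0) ?(gt_eqF L_gt0) ?gt_eqF ?addr_gt0.
rewrite ler_piMr //; first by rewrite mulr_ge0 // ltW.
rewrite ler_pdivrMr ?exprn_gt0 ?addr_gt0 // mul1r.
have : (1 - alpha) ^+ 2 / (2 * L ^+ 4) <= 1.
  rewrite ler_pdivrMr ?mulr_gt0 ?exprn_gt0 // mul1r.
  apply: (@le_trans _ _ 1).
    by rewrite expr_le1 ?(ltW s_gt0) // gerBl (ltW (lqr_alpha0 pb)).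
  have : 1 <= L ^+ 4 by rewrite exprn_ege1 // ltW.
  by lra.
have : 1 + 2 * L <= (1 + L) ^+ 2 by have := sqr_ge0 L; lra.
by lra.
Qed.

End KKTBounds.

(** * Inequalities between the explicit constants *)

Section Constants.
Variables (R : realType) (L alpha gamma : R).
Hypotheses (L_gt1 : 1 < L) (alpha0 : 0 < alpha) (alpha1 : alpha < 1).
Hypothesis gamma0 : 0 < gamma.

Local Notation lH := (LH L alpha).
Local Notation gF := (gammaF L alpha).
Local Notation gG := (gammaG L alpha gamma).
Local Notation gH := (gammaH L alpha gamma).
Local Notation mu := (mubar L alpha gamma).

Let L_gt0 : 0 < L. Proof. exact: lt_trans ltr01 L_gt1. Qed.
Let s_gt0 : 0 < 1 - alpha. Proof. by rewrite subr_gt0. Qed.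
Let lH3 : 3 <= lH.
Proof. by rewrite le_max; apply/orP; left; have := L_gt1; lra. Qed.
Let lH_gt0 : 0 < lH. Proof. by apply: lt_le_trans lH3; rewrite ltr0n. Qed.

Lemma gammaG_gt0 : 0 < gG.
Proof.
have L1_gt0 : 0 < 1 + L by rewrite addr_gt0.
by apply: divr_gt0; rewrite !mulr_gt0 ?exprn_gt0.
Qed.

Lemma gammaF_inv : gF^-1 = (L * (1 + L) / (1 - alpha)) ^+ 2.
Proof. by rewrite /gammaF invf_div !exprMn exprVn. Qed.

Lemma rinv_ge1 : 1 <= L * (1 + L) / (1 - alpha).
Proof.
rewrite ler_pdivlMr // mul1r; have := L_gt1; have := alpha0.
by have := sqr_ge0 L; lra.
Qed.

Lemma gammaF_inv_ge1 : 1 <= gF^-1.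
Proof. by rewrite gammaF_inv exprn_ege1 ?rinv_ge1. Qed.

Lemma mubar_ge1 : 1 <= mu.
Proof.
rewrite /mubar; have := gammaF_inv_ge1; set i := gF^-1 => i1.
have h : 0 <= 2 * lH ^+ 2 / gG.
  by rewrite divr_ge0 ?(ltW gammaG_gt0) // mulr_ge0 ?sqr_ge0.
have gp := gammaG_gt0.
by rewrite -[leLHS]mulr1; apply: ler_pM => //; have := lH3; lra.
Qed.

(** The left side is the constant of [saddle_lower] for the KKT operator. The part linear in [f] is
    absorbed by the [mubar] term, since [f >= 1] and [mubar LH^2 >= 2], and [1 + t] is below the
    square of [1 + 2 t]. *)
Lemma saddle_constant_le :
  gG^-1 + 2 * (L * (1 + L) / (1 - alpha) * (1 + lH / gG))
    + (L * (1 + L) / (1 - alpha)) ^+ 2 * lH * (1 + lH / gG) <= gH^-1.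
Proof.
rewrite /gammaH invrK gammaF_inv /=.
have f1 := rinv_ge1; set f := L * _ / _ in f1 *.
have -> : 4 * lH ^+ 2 / gG ^+ 2 = 4 * (lH / gG) ^+ 2.
  by rewrite -mulrA -expr_div_n.
have -> : 4 * lH / gG = 4 * (lH / gG) by rewrite mulrA.
have t0 : 0 <= lH / gG by rewrite divr_ge0 ?(ltW lH_gt0) ?(ltW gammaG_gt0).
set t := lH / gG in t0 *.
have g0 : 0 < gG^-1 by rewrite invr_gt0 gammaG_gt0.
set g := gG^-1 in g0 *.
have m1 := mubar_ge1; set k := mu in m1 *.
have l3 := lH3; set l := lH in l3 *.
have ff : f <= f ^+ 2 by rewrite expr2 ler_peMr // (le_trans ler01).
have kl : 2 <= k * l ^+ 2.
  have : 1 * 3 ^+ 2 <= k * l ^+ 2.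
    by apply: ler_pM => //; rewrite ?sqr_ge0 // ler_pXn2r ?nnegrE // (le_trans _ l3).
  by lra.
have f0 : 0 <= f by rewrite (le_trans ler01).
have h1 : 2 * f <= f ^+ 2 * (k * l ^+ 2).
  by rewrite mulrC; apply: ler_pM.
have h2 : (1 + t) * (f ^+ 2 * (k * l ^+ 2) + f ^+ 2 * l) <=
   (1 + 4 * t + 4 * t ^+ 2) * (f ^+ 2 * (k * l ^+ 2) + f ^+ 2 * l).
  apply: ler_wpM2r; last by have := sqr_ge0 t; lra.
  apply: addr_ge0; first by apply: le_trans h1; rewrite mulr_ge0.
  by rewrite mulr_ge0 ?sqr_ge0 // (le_trans _ l3).
have h3 : (1 + t) * (2 * f + f ^+ 2 * l) <= (1 + t) * (f ^+ 2 * (k * l ^+ 2) + f ^+ 2 * l).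
  by apply: ler_wpM2l; [rewrite addr_ge0 | rewrite lerD2r].
have -> : g + 2 * (f * (1 + t)) + f ^+ 2 * l * (1 + t) =
  g + (1 + t) * (2 * f + f ^+ 2 * l) by ring.
apply: le_trans (lerD (lexx g) (le_trans h3 h2)) _.
have -> : l * (1 + k * l) * f ^+ 2 = f ^+ 2 * (k * l ^+ 2) + f ^+ 2 * l by ring.
by have := le_trans ler01 m1; lra.
Qed.

Lemma gammaH_gt0 : 0 < gH.
Proof.
rewrite -invr_gt0; apply: lt_le_trans saddle_constant_le.
have f0 : 0 < L * (1 + L) / (1 - alpha) by apply: lt_le_trans rinv_ge1.
have t0 : 0 < 1 + lH / gG.
  exact: addr_gt0 ltr01 (divr_gt0 lH_gt0 gammaG_gt0).
have g0 : 0 < gG^-1 by rewrite invr_gt0 gammaG_gt0.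
have h1 := mulr_gt0 f0 t0.
have h2 := mulr_gt0 (mulr_gt0 (exprn_gt0 2 f0) lH_gt0) t0.
by move: g0 h1 h2; lra.
Qed.

Lemma gammaH_le1 : gH <= 1.
Proof.
rewrite -(invf_ge1 gammaH_gt0).
apply: le_trans saddle_constant_le.
have f1 := rinv_ge1; set f := L * _ / _ in f1 *.
have t0 : 0 <= lH / gG by rewrite divr_ge0 ?(ltW lH_gt0) ?(ltW gammaG_gt0).
have g0 : 0 <= gG^-1 by rewrite invr_ge0 ltW ?gammaG_gt0.
have f0 : 0 <= f by rewrite (le_trans ler01).
have h1 : 1 <= f * (1 + lH / gG).
  by rewrite -[leLHS]mulr1; apply: ler_pM => //; rewrite lerDl.
have h2 : 0 <= f ^+ 2 * lH * (1 + lH / gG).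
  by rewrite mulr_ge0 ?addr_ge0 // mulr_ge0 ?sqr_ge0 // ltW.
by lra.
Qed.

Lemma gammaH_ltLH : gH < lH.
Proof. by apply: le_lt_trans gammaH_le1 _; apply: lt_le_trans lH3; rewrite ltr1n. Qed.

Local Notation rh := (rho L alpha gamma).

Lemma sqr_rho : rh ^+ 2 = (lH ^+ 2 - gH ^+ 2) / (lH ^+ 2 + gH ^+ 2).
Proof.
rewrite sqr_sqrtr // divr_ge0 //; last by rewrite addr_ge0 ?sqr_ge0.
rewrite subr_ge0.
by rewrite ler_pXn2r ?nnegrE ?(ltW gammaH_gt0) ?(ltW lH_gt0) // ltW ?gammaH_ltLH.
Qed.

Lemma rho_gt0 : 0 < rh.
Proof.
rewrite sqrtr_gt0 divr_gt0 //; last by rewrite addr_gt0 ?exprn_gt0 ?gammaH_gt0.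
rewrite subr_gt0.
by rewrite ltr_pXn2r ?nnegrE ?(ltW gammaH_gt0) ?(ltW lH_gt0) // gammaH_ltLH.
Qed.

Lemma rho_lt1 : rh < 1.
Proof.
have h : 0 < lH ^+ 2 + gH ^+ 2 by rewrite addr_gt0 ?exprn_gt0 ?gammaH_gt0.
have g2 : 0 < gH ^+ 2 by rewrite exprn_gt0 ?gammaH_gt0.
rewrite -(ltr_pXn2r (_ : 0 < 2)%N) ?nnegrE ?(ltW rho_gt0) // sqr_rho expr1n.
by rewrite ltr_pdivrMr // mul1r; lra.
Qed.

Lemma delta_bounds : 0 < delta L alpha gamma /\ delta L alpha gamma < 1.
Proof. by rewrite /delta; have := rho_gt0; have := rho_lt1; lra. Qed.

Lemma rho_lt_delta : rh < delta L alpha gamma.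
Proof. by rewrite /delta; have := rho_lt1; lra. Qed.

Lemma UpsilonE d : rh ^+ d * (lH / gH ^+ 2) = Upsilon L alpha gamma * rh ^+ d.+1.
Proof.
by rewrite /Upsilon (exprS _ d); field; rewrite !gt_eqF ?rho_gt0 ?gammaH_gt0.
Qed.

Lemma Upsilon_ge1 : 1 <= Upsilon L alpha gamma.
Proof.
rewrite /Upsilon ler_pdivlMr ?mulr_gt0 ?exprn_gt0 ?gammaH_gt0 ?rho_gt0 // mul1r.
apply: (@le_trans _ _ (1 * 1)); last by rewrite mulr1; have := lH3; lra.
apply: ler_pM; rewrite ?sqr_ge0 ?(ltW rho_gt0) ?(ltW rho_lt1) //.
by rewrite exprn_ile1 ?gammaH_le1 ?(ltW gammaH_gt0).
Qed.

(** Approximants that cannot reach distance [d] have degree at most [d - 1], so [k = d./2] and the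
    decay obtained is only [rho^(2k) <= rho^(d-1)]. The [rho] in the denominator of [Upsilon]
    restores the missing power; for [d = 0] none is missing. *)
Lemma inv_gammaH_le d : gH^-1 * rh ^+ d.-1 <= Upsilon L alpha gamma * rh ^+ d.
Proof.
have g_gt0 := gammaH_gt0; have r_gt0 := rho_gt0.
have h : gH^-1 <= lH / gH ^+ 2.
  rewrite ler_pdivlMr ?exprn_gt0 // expr2 mulKf ?gt_eqF //.
  exact: ltW gammaH_ltLH.
case: d => [|d] /=.
  rewrite !mulr1; apply: le_trans h _.
  have -> : Upsilon L alpha gamma = lH / gH ^+ 2 * rh^-1.
    by rewrite /Upsilon; field; rewrite !gt_eqF.
  rewrite ler_peMr //; first exact: divr_ge0 (ltW lH_gt0) (sqr_ge0 _).
  by rewrite invf_ge1 // ltW ?rho_lt1.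
by rewrite -UpsilonE mulrC ler_wpM2l ?exprn_ge0 // ltW.
Qed.

End Constants.

(** * Two-sided bounds for the KKT operator *)

Section KKTNorm.
Variables (R : realType) (n m : nat) (L alpha gamma : R).
Variables (A : 'M[R]_n) (B : 'M[R]_(n, m)) (Q : 'M[R]_n) (Rc : 'M[R]_m).
Hypothesis pb : lqr_problem L alpha gamma A B Q Rc.
Variable P : 'M[R]_n.
Hypotheses (P_psd : psdmx P)
  (P_le : forall v, norm2 (P *m v) <= LP L alpha * norm2 v).
Variable T : nat.

Let L_gt0 : 0 < L. Proof. exact: lt_trans ltr01 (lqr_L pb). Qed.
Let L_ge0 : 0 <= L. Proof. exact: ltW. Qed.
Let a0 := lqr_alpha0 pb.
Let a1 := lqr_alpha1 pb.
Let g0 := lqr_gamma0 pb.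
Let lH_gt0 : 0 < LH L alpha.
Proof. by apply: lt_le_trans (LH_ge3 pb); rewrite ltr0n. Qed.

Lemma kkt_selfadj z z' :
  dot_kkt T (kkt A B Q Rc P T z) z' = dot_kkt T z (kkt A B Q Rc P T z').
Proof.
apply: kkt_selfadjoint; [exact: lqr_Q_sym pb | exact: lqr_R_sym pb | by case: P_psd].
Qed.

Lemma kkt_ge z : gammaH L alpha gamma * snorm (dot_kkt T) z <=
  snorm (dot_kkt T) (kkt A B Q Rc P T z).
Proof.
have gH0 := gammaH_gt0 (lqr_L pb) a0 a1 g0.
rewrite mulrC -ler_pdivlMr // [leRHS]mulrC.
have f0 : 0 <= L * (1 + L) / (1 - alpha).
  by apply: le_trans (rinv_ge1 (lqr_L pb) a0 a1).
have gG0 := gammaG_gt0 (lqr_L pb) a1 g0.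
have := saddle_lower (dot_primalP T) (dot_dualP T) f0 (ltW lH_gt0) gG0
  (dyn_adjP A B T) (cost_op_le pb P_le T) (dyn_op_rinv pb T)
  (cost_op_coercive pb P_psd T) z.
move=> /le_trans; apply; rewrite ler_wpM2r ?snorm_ge0 //.
exact: saddle_constant_le (lqr_L pb) a0 a1 g0.
Qed.

(* The quadratic form of the operator, block row by block row: each state,
   control or multiplier is met with total weight at most [LH]. *)
Lemma kkt_le z : snorm (dot_kkt T) (kkt A B Q Rc P T z) <=
  LH L alpha * snorm (dot_kkt T) z.
Proof.
apply: (snorm_selfadjoint (dot_kktP T)) => // [|u v|{}z].
- exact: linearP.
- exact: kkt_selfadj.
have dn := @dotvP R n; have dm := @dotvP R m.
case: z => -[x u] l; rewrite /dot_kkt /inner_pair /kkt /saddle /=.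
rewrite (innerDl (dot_primalP T)) (innerC (dot_primalP T) (dyn_adj _ _ _ _)) -dyn_adjP.
rewrite /dot_primal /inner_pair /dot_dual /inner_sum /=.
set f := \sum_(t < T.+1) dotv (dyn_op _ _ _ _) _.
(* The constraint and its adjoint contribute the same amount [f] to the quadratic form. *)
rewrite -[_ + f + f]addrA -mulr2n.
have -> : f *+ 2 = \sum_(t < T.+1) 2 * dotv (x t) (l t)
    - \sum_(t < T) (2 * dotv (A *m x t) (l t.+1) + 2 * dotv (B *m u t) (l t.+1)).
  have -> : f = \sum_(t < T.+1) dotv (x t) (l t)
      - \sum_(t < T) (dotv (A *m x t) (l t.+1) + dotv (B *m u t) (l t.+1)).
    rewrite /f; under eq_bigr do rewrite (innerBl dn).
    rewrite big_split /=; congr (_ + _).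
    rewrite big_ord_recl /= (inner0l dn) oppr0 add0r -sumrN.
    by apply: eq_bigr => t _; rewrite (innerDl dn).
  rewrite -[LHS]mulr_natl mulrBr !mulr_sumr; congr (_ - _).
  by apply: eq_bigr => t _; rewrite mulrDr.
have q k (M : 'M[R]_k) c v : (forall v, norm2 (M *m v) <= c * norm2 v) ->
    0 <= c -> `|dotv (M *m v) v| <= c * dotv v v.
  move=> h c0; have := norm2_quad v v c0 h; rewrite (innerC (dotvP k) v).
  by rewrite !ler_norml => /andP[? ?]; apply/andP; lra.
have q2 k (M : 'M[R]_(n, k)) v w : (forall v, norm2 (M *m v) <= L * norm2 v) ->
    `|2 * dotv (M *m v) w| <= L * (dotv v v + dotv w w).
  by move=> h; have := norm2_quad w v L_ge0 h; rewrite (innerC dn w) addrC.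
have qI (v w : 'cV[R]_n) : `|2 * dotv v w| <= dotv v v + dotv w w :> R.
  have := @norm2_quad R n n 1%:M 1 v w ler01; rewrite mul1mx mul1r; apply.
  by move=> y; rewrite mul1mx mul1r.
pose sx := \sum_(t < T) dotv (x t) (x t); pose xT := dotv (x T) (x T).
pose su := \sum_(t < T) dotv (u t) (u t).
pose sl := \sum_(t < T) dotv (l t.+1) (l t.+1); pose l0 := dotv (l 0%N) (l 0%N).
have sx0 : 0 <= sx by apply: sumr_ge0 => t _; apply: (inner_ge0 dn).
have su0 : 0 <= su by apply: sumr_ge0 => t _; apply: (inner_ge0 dm).
have sl0 : 0 <= sl by apply: sumr_ge0 => t _; apply: (inner_ge0 dn).
have l00 : 0 <= l0 by apply: (inner_ge0 dn).
have xT0 : 0 <= xT by apply: (inner_ge0 dn).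
have -> : \sum_(t < T.+1) dotv (x t) (x t) = sx + xT by rewrite big_ord_recr.
have lE : \sum_(t < T.+1) dotv (l t) (l t) = l0 + sl by rewrite big_ord_recl.
rewrite lE.
have b1 : `|\sum_(t < T.+1) dotv ((if (t < T)%N then Q else P) *m x t) (x t)|
    <= L * sx + LP L alpha * xT.
  rewrite big_ord_recr /= ltnn; apply: le_trans (ler_normD _ _) _; apply: lerD.
    apply: le_trans (ler_norm_sum _ _ _) _; rewrite mulr_sumr.
    by apply: ler_sum => t _; rewrite ltn_ord; apply: q (lqr_Q pb) _.
  by apply: q => //; apply/ltW/(LP_pos pb).
have b2 : `|\sum_(t < T) dotv (if (t < T)%N then Rc *m u t else 0) (u t)| <= L * su.
  apply: le_trans (ler_norm_sum _ _ _) _; rewrite mulr_sumr.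
  by apply: ler_sum => t _; rewrite ltn_ord; apply: q (lqr_R pb) _.
have b3 : `|\sum_(t < T.+1) 2 * dotv (x t) (l t)| <= sx + xT + (l0 + sl).
  apply: le_trans (ler_norm_sum _ _ _) _; rewrite -lE.
  have -> : sx + xT = \sum_(t < T.+1) dotv (x t) (x t) by rewrite big_ord_recr.
  by rewrite -big_split; apply: ler_sum => t _.
have b4 : `|\sum_(t < T) (2 * dotv (A *m x t) (l t.+1) + 2 * dotv (B *m u t) (l t.+1))|
    <= L * (sx + sl) + L * (su + sl).
  apply: le_trans (ler_norm_sum _ _ _) _; rewrite -!big_split /= !mulr_sumr -big_split.
  apply: ler_sum => t _; apply: le_trans (ler_normD _ _) _; apply: lerD; apply: q2.
    exact: lqr_A pb.
  exact: lqr_B pb.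
apply: le_trans (ler_normD _ _) _; apply: le_trans (lerD (ler_normD _ _) (ler_normB _ _)) _.
(* Total weights: [2 L + 1] for states before [T] and for multipliers after time 0, [LP + 1] for the
   state at [T], [2 L] for controls, 1 for the initial multiplier. [LH] is the largest of these. *)
apply: le_trans (lerD (lerD b1 b2) (lerD b3 b4)) _.
have h1 := ler_wpM2r sx0 (LH_ge_L L alpha).
have h2 := ler_wpM2r xT0 (LH_ge_LP L alpha).
have h3 := ler_wpM2r su0 (LH_ge_L L alpha).
have h4 := ler_wpM2r sl0 (LH_ge_L L alpha).
have h5 := ler_wpM2r l00 (LH_ge_L L alpha).
have h6 := mulr_ge0 L_ge0 l00.
rewrite -/su; lra.
Qed.

End KKTNorm.

(** * Decay of the optimal trajectory in space and time *)

(** Blocks are given by a labelling [f] of the coordinates and keep the full dimension, so parts can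
    be summed without casts and the one-block labelling is allowed. *)
Definition block_part (R : realType) (I : eqType) n (f : 'I_n -> I) (i : I)
    (v : 'cV[R]_n) : 'cV[R]_n :=
  \col_s (if f s == i then v s 0 else 0).

Definition mx_sparse (R : realType) (I : Type) (near : rel I) m n
    (f : 'I_m -> I) (g : 'I_n -> I) (M : 'M[R]_(m, n)) : Prop :=
  forall s s', ~~ near (f s) (g s') -> M s s' = 0.

Lemma norm2_block_part (R : realType) (I : eqType) n (f : 'I_n -> I) i (v : 'cV[R]_n) :
  norm2 (block_part f i v) <= norm2 v.
Proof.
rewrite /norm2 ler_wsqrtr //; apply: ler_sum => s _; rewrite mxE.
by case: ifP => // _; rewrite expr0n sqr_ge0.
Qed.

Lemma mx_sparse_mul0 (R : realType) (I : Type) (near : rel I) m n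
    (f : 'I_m -> I) (g : 'I_n -> I) (M : 'M[R]_(m, n)) (v : 'cV_n) s :
  mx_sparse near f g M -> (forall s', near (f s) (g s') -> v s' 0 = 0) ->
  (M *m v) s 0 = 0.
Proof.
move=> Ms v0; rewrite mxE big1 // => s' _.
have [nr|fr] := boolP (near (f s) (g s')); first by rewrite v0 // mulr0.
by rewrite Ms // mul0r.
Qed.

Lemma mx_sparse_tr (R : realType) (I : Type) (near : rel I) m n
    (f : 'I_m -> I) (g : 'I_n -> I) (M : 'M[R]_(m, n)) :
  symmetric near -> mx_sparse near f g M -> mx_sparse near g f M^T.
Proof. by move=> nsym Ms s s' h; rewrite mxE Ms // nsym. Qed.

(** * Finite speed of propagation under the KKT operator *)

Section Propagation.
Variables (R : realType) (I : Type) (near : rel I) (n m : nat).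
Variables (f : 'I_n -> I) (g : 'I_m -> I).
Variables (A : 'M[R]_n) (B : 'M[R]_(n, m)) (Q : 'M[R]_n) (Rc : 'M[R]_m).
Hypothesis near_sym : symmetric near.
Hypotheses (As : mx_sparse near f f A) (Bs : mx_sparse near f g B).
Hypotheses (Qs : mx_sparse near f f Q) (Rs : mx_sparse near g g Rc).
Variables (P : 'M[R]_n) (T : nat).

(* [far r t i]: the space-time node [(t, i)] is at distance more than [r] from
   the source. The terminal cost [P] couples all nodes at times [t >= T]. *)
Variable far : nat -> nat -> I -> bool.
Hypothesis far_mono : forall r t i, far r.+1 t i -> far r t i.
Hypothesis far_near : forall r t i i', far r.+1 t i -> near i i' ->
  [/\ far r t i', far r t.+1 i' & far r t.-1 i'].
Hypothesis far_end : forall r t i i', (T <= t)%N -> far r.+1 t i -> far r t i'.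

Definition supported (r : nat)
    (z : (nat -> 'cV[R]_n) * (nat -> 'cV[R]_m) * (nat -> 'cV[R]_n)) : Prop :=
  forall t, [/\ forall s, far r t (f s) -> z.1.1 t s 0 = 0,
    forall s, far r t (g s) -> z.1.2 t s 0 = 0 &
    forall s, far r t (f s) -> z.2 t s 0 = 0].

Lemma supported0 r : supported r 0.
Proof. by move=> t; split=> s _; rewrite mxE. Qed.

Lemma supportedP r a u v : supported r u -> supported r v -> supported r (a *: u + v).
Proof.
move=> su sv t; have [su1 su2 su3] := su t; have [sv1 sv2 sv3] := sv t.
split=> s fr.
- by have := su1 s fr; have := sv1 s fr => v0 u0; rewrite [LHS]mxE v0 addr0 mxE u0 mulr0.
- by have := su2 s fr; have := sv2 s fr => v0 u0; rewrite [LHS]mxE v0 addr0 mxE u0 mulr0.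
- by have := su3 s fr; have := sv3 s fr => v0 u0; rewrite [LHS]mxE v0 addr0 mxE u0 mulr0.
Qed.

Lemma supported_mono r u : supported r u -> supported r.+1 u.
Proof.
by move=> su t; have [su1 su2 su3] := su t; split=> s /far_mono; [exact: su1|exact: su2|exact: su3].
Qed.

(** Cost rows look at neighbours at the same time, adjoint rows at the next time and dynamics rows
    at the previous one, so one application spreads a support by one step; the dense terminal row is
    covered by [far_end]. *)
Lemma supported_kkt r z : supported r z -> supported r.+1 (kkt A B Q Rc P T z).
Proof.
case: z => -[x u] l sz.
have x0 t s : far r t (f s) -> x t s 0 = 0 by have [h _ _] := sz t; apply: h.
have u0 t s : far r t (g s) -> u t s 0 = 0 by have [_ h _] := sz t; apply: h.
have l0 t s : far r t (f s) -> l t s 0 = 0 by have [_ _ h] := sz t; apply: h.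
move=> t; split=> s fr.
- change (((if (t < T)%N then Q else P) *m x t
    + (l t - (if (t < T)%N then A^T *m l t.+1 else 0))) s 0 = 0).
  rewrite mxE [X in _ + X]mxE (l0 _ _ (far_mono fr)) add0r.
  have -> : ((if (t < T)%N then Q else P) *m x t) s 0 = 0.
    case: ltnP => tT; first by apply: (mx_sparse_mul0 Qs) => s' /(far_near fr)[h _ _]; apply: x0.
    by rewrite mxE big1 // => s' _; rewrite x0 ?mulr0 //; apply: far_end fr.
  rewrite add0r; case: ltnP => tT; last by rewrite oppr0 mxE.
  rewrite mxE (mx_sparse_mul0 (mx_sparse_tr near_sym As)) ?oppr0 // => s'.
  by case/(far_near fr) => _ h _; apply: l0.
- change (((if (t < T)%N then Rc *m u t else 0)
    + (if (t < T)%N then - (B^T *m l t.+1) else 0)) s 0 = 0).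
  case: ltnP => tT; last by rewrite addr0 mxE.
  rewrite mxE (mx_sparse_mul0 Rs) ?add0r => [|s' /(far_near fr)[h _ _]]; last exact: u0.
  rewrite mxE (mx_sparse_mul0 (mx_sparse_tr near_sym Bs)) ?oppr0 // => s'.
  by case/(far_near fr) => _ h _; apply: l0.
- change ((x t - (if t is t'.+1 then A *m x t' + B *m u t' else 0)) s 0 = 0).
  rewrite mxE (x0 _ _ (far_mono fr)) add0r mxE.
  case: t fr => [|t] fr; first by rewrite mxE oppr0.
  rewrite mxE (mx_sparse_mul0 As) ?add0r => [|s' /(far_near fr)[_ _ h]]; last exact: x0.
  rewrite (mx_sparse_mul0 Bs) ?oppr0 // => s'.
  by case/(far_near fr) => _ _ h; apply: u0.
Qed.

End Propagation.

Section OptimalDecay.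
Variables (R : realType) (n m : nat) (L alpha gamma : R).
Variables (A : 'M[R]_n) (B : 'M[R]_(n, m)) (Q : 'M[R]_n) (Rc : 'M[R]_m).
Hypothesis pb : lqr_problem L alpha gamma A B Q Rc.
Variable P : 'M[R]_n.
Hypotheses (P_psd : psdmx P) (P_dare : dare A B Q Rc P).

Let L_gt0 : 0 < L. Proof. exact: lt_trans ltr01 (lqr_L pb). Qed.
Let L_ge0 : 0 <= L. Proof. exact: ltW. Qed.
Let a0 := lqr_alpha0 pb.
Let a1 := lqr_alpha1 pb.
Let g0 := lqr_gamma0 pb.
Let gH_gt0 := gammaH_gt0 (lqr_L pb) a0 a1 g0.

Local Notation K := (lqr_gain A B Rc P).
Local Notation Phi := (A - B *m K).
Local Notation rh := (rho L alpha gamma).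
Local Notation Up := (Upsilon L alpha gamma).
Local Notation gH := (gammaH L alpha gamma).

Lemma optimal_P_le v : norm2 (P *m v) <= LP L alpha * norm2 v.
Proof.
have [Kb [Kb_le Kb_stable]] := lqr_stab pb.
exact: (riccati_norm_le L_ge0 (ltW a0) a1 g0 (lqr_Q pb) (lqr_R pb) (lqr_R_sym pb)
  (lqr_R_ge pb) P_psd P_dare Kb_le Kb_stable).
Qed.

Definition optimal_traj (x : 'cV[R]_n) :
    (nat -> 'cV[R]_n) * (nat -> 'cV[R]_m) * (nat -> 'cV[R]_n) :=
  ((fun t => Phi ^+ t *m x, fun t => - (K *m (Phi ^+ t *m x))),
   fun t => - (P *m (Phi ^+ t *m x))).

(** At the horizon the terminal cost cancels the multiplier exactly, so one infinite-horizon
    trajectory serves all [T]. *)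
Lemma kkt_optimal T x : kkt A B Q Rc P T (optimal_traj x) =
  (0, fun t => if t is 0%N then x else 0).
Proof.
have stat := gain_stationary A B g0 (lqr_R_ge pb) P_psd.
have loop := riccati_closed_loop P_dare.
have PhiS t : Phi ^+ t.+1 *m x = Phi *m (Phi ^+ t *m x) by rewrite expmxS mulmxA.
congr pair; first congr pair; apply/funext => t.
- change ((if (t < T)%N then Q else P) *m (Phi ^+ t *m x)
    + (- (P *m (Phi ^+ t *m x))
       - (if (t < T)%N then A^T *m - (P *m (Phi ^+ t.+1 *m x)) else 0)) = 0).
  case: ltnP => tT; last by rewrite subr0 subrr.
  rewrite PhiS mulmxN opprK {2}loop mulmxDl.
  by rewrite -!mulmxA opprD addrA addrA subrr add0r addNr.
- change ((if (t < T)%N then Rc *m - (K *m (Phi ^+ t *m x)) else 0)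
    + (if (t < T)%N then - (B^T *m - (P *m (Phi ^+ t.+1 *m x))) else 0) = 0).
  case: ltnP => tT; last by rewrite addr0.
  rewrite PhiS !mulmxN opprK [Rc *m _]mulmxA stat -!mulmxA addNr //.
- change (Phi ^+ t *m x - (if t is s.+1
    then A *m (Phi ^+ s *m x) + B *m - (K *m (Phi ^+ s *m x)) else 0) =
    if t is 0%N then x else 0).
  case: t => [|t]; first by rewrite expr0 mul1mx subr0.
  by rewrite PhiS mulmxBl mulmxN -mulmxA subrr.
Qed.

Lemma snorm_kkt_optimal T x :
  snorm (dot_kkt T) (kkt A B Q Rc P T (optimal_traj x)) = norm2 x.
Proof.
rewrite kkt_optimal norm2E /snorm /dot_kkt /inner_pair (inner0l (dot_primalP T)).
rewrite /= /dot_dual /inner_sum big_ord_recl /= add0r big1 ?addr0 // => t _.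
by rewrite (inner0l (dotvP n)).
Qed.

Lemma optimal_traj_le T x :
  snorm (dot_kkt T) (optimal_traj x) <= gH^-1 * norm2 x.
Proof.
rewrite mulrC ler_pdivlMr // mulrC -(snorm_kkt_optimal T).
by have := kkt_ge pb P_psd optimal_P_le T (optimal_traj x).
Qed.

Lemma snorm_state_le T (z : (nat -> 'cV[R]_n) * (nat -> 'cV[R]_m) * (nat -> 'cV[R]_n)) t :
  (t <= T)%N -> norm2 (z.1.1 t) <= snorm (dot_kkt T) z.
Proof.
move=> tT; rewrite norm2E.
apply: le_trans (snorm_fst _ (dot_dualP T) z).
apply: le_trans (snorm_fst _ (semi_inner_sum (dotvP m) T) z.1).
exact: (snorm_coord (dotvP n)).
Qed.

Lemma snorm_control_le T (z : (nat -> 'cV[R]_n) * (nat -> 'cV[R]_m) * (nat -> 'cV[R]_n)) t :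
  (t < T)%N -> norm2 (z.1.2 t) <= snorm (dot_kkt T) z.
Proof.
move=> tT; rewrite norm2E.
apply: le_trans (snorm_fst _ (dot_dualP T) z).
apply: le_trans (snorm_snd _ (dot_dualP T) z.1).
exact: (snorm_coord (dotvP m)).
Qed.

Lemma optimal_approx T x (S : nat -> _ -> Prop) k :
  (forall r, S r 0) ->
  (forall r a u v, S r u -> S r v -> S r (a *: u + v)) ->
  (forall r u, S r u -> S r.+1 u) ->
  (forall r u, S r u -> S r.+1 (kkt A B Q Rc P T u)) ->
  S 0%N (kkt A B Q Rc P T (optimal_traj x)) ->
  exists2 y, S k.*2.-1 y &
    snorm (dot_kkt T) (optimal_traj x - y) <= gH^-1 * rh ^+ k.*2 * norm2 x.
Proof.
move=> S0 SP Sm SH Sb.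
have [y Sy y_le] := inverse_decay (dot_kktP T) gH_gt0
  (gammaH_ltLH (lqr_L pb) a0 a1 g0) (kkt_selfadj pb P_psd T) (kkt_le pb P_psd optimal_P_le T)
  (kkt_ge pb P_psd optimal_P_le T) S0 SP Sm SH k Sb.
exists y => //; apply: le_trans y_le _.
have rhoE := sqr_rho (lqr_L pb) a0 a1 g0; rewrite -rhoE -exprM mul2n -mulrA mulrCA.
by rewrite ler_wpM2l ?optimal_traj_le // exprn_ge0 // (ltW (rho_gt0 (lqr_L pb) a0 a1 g0)).
Qed.

Lemma rho_half_le d : rh ^+ d./2.*2 <= rh ^+ d.-1.
Proof.
have [r_gt0 r_lt1] := (rho_gt0 (lqr_L pb) a0 a1 g0, rho_lt1 (lqr_L pb) a0 a1 g0).
by apply: ler_wiXn2l; rewrite ?ltW //; lia.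
Qed.

(** Space is collapsed to one point: every matrix is then sparse, the distance from the source is
    time alone, and the dense terminal cost does no harm, so the horizon can be the time of
    interest. *)
Lemma closed_loop_decay t x : norm2 (Phi ^+ t *m x) <= Up * rh ^+ t * norm2 x.
Proof.
case: t => [|t].
  by rewrite !expr0 mul1mx mulr1 ler_peMl ?norm2_ge0 ?(Upsilon_ge1 (lqr_L pb)).
pose far (r t : nat) (i : unit) := (r < t)%N.
pose f k (s : 'I_k) := tt; pose near (i j : unit) := true.
have sp k k' (M : 'M[R]_(k, k')) : mx_sparse near (@f k) (@f k') M by [].
have far_mono r t' i : far r.+1 t' i -> far r t' i by apply: ltnW.
have far_near r t' i i' : far r.+1 t' i -> near i i' ->
    [/\ far r t' i', far r t'.+1 i' & far r t'.-1 i'].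
  by rewrite /far => h _; split; lia.
have far_end r t' i i' : (t.+1 <= t')%N -> far r.+1 t' i -> far r t' i'.
  by move=> _; apply: ltnW.
have [|y Sy y_le] := @optimal_approx t.+1 x (supported (@f n) (@f m) far) t.+1./2
  (@supported0 _ _ _ _ _ _ _) (@supportedP _ _ _ _ _ _ _)
  (@supported_mono _ _ _ _ _ _ _ far_mono)
  (@supported_kkt _ _ near _ _ _ _ _ _ _ _ (fun _ _ => erefl) (sp _ _ A) (sp _ _ B)
    (sp _ _ Q) (sp _ _ Rc) P t.+1 far far_mono far_near far_end).
  by rewrite kkt_optimal => -[|t']; split=> s //=; rewrite mxE.
have yt : y.1.1 t.+1 = 0.
  apply/matrixP => s j; rewrite (ord1 j) mxE.
  by have [h _ _] := Sy t.+1; apply: h; rewrite /far; lia.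
have -> : Phi ^+ t.+1 *m x = (optimal_traj x - y).1.1 t.+1.
  by rewrite -[LHS]subr0 -yt.
apply: le_trans (snorm_state_le _ (leqnn _)) _; apply: le_trans y_le _.
rewrite ler_wpM2r ?norm2_ge0 //.
apply: le_trans (inv_gammaH_le (lqr_L pb) a0 a1 g0 _).
by rewrite ler_wpM2l ?rho_half_le // invr_ge0 ltW.
Qed.

Section Space.
Variables (I : eqType) (near : rel I) (f : 'I_n -> I) (g : 'I_m -> I).
Hypothesis near_sym : symmetric near.
Hypotheses (As : mx_sparse near f f A) (Bs : mx_sparse near f g B).
Hypotheses (Qs : mx_sparse near f f Q) (Rs : mx_sparse near g g Rc).
Variable ball : nat -> I -> bool.
Hypothesis ball_mono : forall r i, ball r i -> ball r.+1 i.
Hypothesis ball_near : forall r i i', ball r i' -> near i i' -> ball r.+1 i.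

(** The source [x] lives on the initial ball, and [- K x] is the control at time 0, so its blocks
    decay with their distance from that ball. *)
Lemma gain_decay d i (x : 'cV[R]_n) : (forall s, ~~ ball 0 (f s) -> x s 0 = 0) ->
  (forall r, (r < d)%N -> ~~ ball r i) ->
  norm2 (block_part g i (K *m x)) <= Up * rh ^+ d * norm2 x.
Proof.
move=> x_supp i_far.
have u0E : (optimal_traj x).1.2 0%N = - (K *m x) by rewrite /= expr0 mul1mx.
have block_partN v : norm2 (block_part g i (- v)) = norm2 (block_part g i v).
  rewrite !norm2E -[RHS](snormN (dotvP m)); congr snorm.
  by apply/matrixP => s j; rewrite !mxE; case: ifP; rewrite ?oppr0.
rewrite -block_partN -u0E.
case: d i_far => [_|d i_far].
  apply: le_trans (norm2_block_part _ _ _) _.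
  apply: le_trans (snorm_control_le _ (ltn0Sn 0)) _.
  apply: le_trans (optimal_traj_le _ _) _; rewrite ler_wpM2r ?norm2_ge0 //.
  by have := inv_gammaH_le (lqr_L pb) a0 a1 g0 0; rewrite mulr1.
pose T := d.+2.
(* Being far means more than [r] from the source in space and from [T] in time. No node is far at
   times [t >= T], which makes [far_end] vacuous, while time 0 remains out of reach of [T] for every
   degree used. *)
pose far (r t : nat) (i : I) := (t + r < T)%N && ~~ ball r i.
have far_mono r t k : far r.+1 t k -> far r t k.
  move=> /andP[h1 h2]; apply/andP; split; first by lia.
  by apply: contra h2; apply: ball_mono.
have far_near r t k k' : far r.+1 t k -> near k k' ->
    [/\ far r t k', far r t.+1 k' & far r t.-1 k'].
  move=> /andP[h1 h2] nr.
  have h3 : ~~ ball r k' by apply: contra h2 => /ball_near; apply.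
  have h4 : (t.+1 + r < T)%N by rewrite addSnnS.
  rewrite /far h3 !andbT h4; split=> //; first exact: ltnW h4.
  by apply: leq_ltn_trans (ltnW h4); rewrite leq_add2r leq_pred.
have far_end r t k k' : (T <= t)%N -> far r.+1 t k -> far r t k'.
  by move=> tT /andP[h1 _]; lia.
have [|y Sy y_le] := @optimal_approx T x (supported f g far) d.+1./2
  (@supported0 _ _ _ _ _ _ _) (@supportedP _ _ _ _ _ _ _)
  (@supported_mono _ _ _ _ _ _ _ far_mono)
  (@supported_kkt _ _ _ _ _ _ _ _ _ _ _ near_sym As Bs Qs Rs P T far far_mono far_near far_end).
  rewrite kkt_optimal => -[|t']; split=> s //=; rewrite ?mxE // => /andP[_ h].
  exact: x_supp.
have -> : block_part g i ((optimal_traj x).1.2 0%N) =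
    block_part g i ((optimal_traj x - y).1.2 0%N).
  apply/matrixP => s j; rewrite [LHS]mxE [RHS]mxE; case: eqP => // si.
  have [_ h _] := Sy 0%N.
  have -> : (optimal_traj x - y).1.2 0%N s 0 =
    (optimal_traj x).1.2 0%N s 0 - y.1.2 0%N s 0.
    by rewrite [LHS]mxE; congr (_ + _); rewrite mxE.
  by rewrite h ?subr0 // si /far i_far ?andbT; rewrite /T; lia.
apply: le_trans (norm2_block_part _ _ _) _.
apply: le_trans (snorm_control_le _ (ltn0Sn _)) _; apply: le_trans y_le _.
rewrite ler_wpM2r ?norm2_ge0 //.
apply: le_trans (inv_gammaH_le (lqr_L pb) a0 a1 g0 _).
by rewrite ler_wpM2l ?rho_half_le // invr_ge0 ltW.
Qed.

End Space.
End OptimalDecay.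

(** * Graph distance and the truncation error *)

Section GraphDistance.
Variables (T : finType) (e : rel T).

Lemma walkP i j n :
  reflect (exists s, [/\ size s = n, path e i s & last i s = j]) (walk e i j n).
Proof.
apply: (iffP existsP) => [[s /andP[ps /eqP ls]]|[s [<- ps ls]]].
  by exists s; rewrite size_tuple.
by exists (in_tuple s); rewrite /= ps ls eqxx.
Qed.

Lemma walk0 i : walk e i i 0.
Proof. by apply/walkP; exists [::]. Qed.

Lemma walkS i k j n : e i k -> walk e k j n -> walk e i j n.+1.
Proof.
move=> eik /walkP[s [sn ps ls]]; apply/walkP; exists (k :: s).
by rewrite /= sn eik ps.
Qed.

Lemma walk_sym i j n : symmetric e -> walk e i j n -> walk e j i n.
Proof.
move=> esym /walkP[s [sn ps ls]]; apply/walkP; exists (rev (belast i s)).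
rewrite size_rev size_belast -ls rev_path; split=> //.
  by rewrite (eq_path (e' := e)) // => x y; rewrite /= esym.
by case: s {sn ps ls} => //= k s; rewrite rev_cons last_rcons.
Qed.

Lemma gdistP i j :
  if gdist e i j is Some d
  then walk e i j d /\ (forall n, walk e i j n -> (d <= n)%N)
  else forall n, ~~ walk e i j n.
Proof.
rewrite /gdist; case: pselect => [ex|nex]; last first.
  by move=> n; apply/negP => w; apply: nex; exists n.
by case: ex_minnP => d wd dmin.
Qed.

Lemma gdist_leP i j r :
  reflect (exists2 n, (n <= r)%N & walk e i j n) (gdist_le e i j r).
Proof.
rewrite /gdist_le; have := gdistP i j; case: gdist => [d [wd dmin]|nw].
  by apply: (iffP idP) => [dr|[n nr /dmin /leq_trans]]; [exists d|apply].
by apply: (iffP idP) => // -[n _]; rewrite (negPf (nw n)).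
Qed.

Lemma gdist_sym i j : symmetric e -> gdist e i j = gdist e j i.
Proof.
move=> esym; have := gdistP i j; have := gdistP j i.
case: (gdist e i j) => [d|]; case: (gdist e j i) => [d'|] //.
- move=> [w' min'] [w min]; congr Some; apply/eqP; rewrite eqn_leq.
  by rewrite min ?min' //; apply: walk_sym.
- by move=> nw [/(walk_sym esym) w _]; rewrite (negPf (nw d)) in w.
- by move=> [/(walk_sym esym) w _] nw; rewrite (negPf (nw d')) in w.
Qed.

End GraphDistance.

(** * Operator norms from block estimates *)

Section BlockNorm.
Variable R : realType.

Lemma sum_block_part (I : finType) n (f : 'I_n -> I) (v : 'cV[R]_n) :
  \sum_i block_part f i v = v.
Proof.
apply/matrixP => s j; rewrite (ord1 j) summxE (bigD1 (f s)) //= mxE eqxx.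
by rewrite big1 ?addr0 // => i /negPf; rewrite mxE eq_sym => ->.
Qed.

Lemma dotv_block_part (I : finType) n (f : 'I_n -> I) (u v : 'cV[R]_n) :
  \sum_i dotv (block_part f i u) (block_part f i v) = dotv u v.
Proof.
under eq_bigr do rewrite dotvE.
rewrite exchange_big /= dotvE; apply: eq_bigr => s _.
rewrite (bigD1 (f s)) //= !mxE eqxx big1 ?addr0 // => i /negPf.
by rewrite !mxE eq_sym => ->; rewrite mul0r.
Qed.

Lemma block_part_sum (I J : finType) n (f : 'I_n -> I) i (v : J -> 'cV[R]_n) :
  block_part f i (\sum_j v j) = \sum_j block_part f i (v j).
Proof.
apply/matrixP => s k; rewrite (ord1 k) mxE !summxE.
case: ifP => si; first by apply: eq_bigr => j _; rewrite mxE si.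
by rewrite big1 // => j _; rewrite mxE si.
Qed.

(** Schur test with unit weights: after the arithmetic-geometric inequality on each pair of blocks,
    row sums collect the test vector [y] and column sums collect [v]. *)
Lemma block_schur (I : finType) m n (f : 'I_m -> I) (g : 'I_n -> I)
    (M : 'M[R]_(m, n)) (a : I -> I -> R) c :
  0 < c -> (forall i j, 0 <= a i j) ->
  (forall i j v, norm2 (block_part f i (M *m block_part g j v)) <=
    a i j * norm2 (block_part g j v)) ->
  (forall i, \sum_j a i j <= c) -> (forall j, \sum_i a i j <= c) ->
  forall v, norm2 (M *m v) <= c * norm2 v.
Proof.
move=> c0 a0 M_le rows cols v; rewrite !norm2E.
apply: (snorm_dual (dotvP m)) (snorm_ge0 _ _) _ => // y.
rewrite (sqr_snorm (dotvP n)).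
rewrite -(dotv_block_part f y (M *m v)) -[X in M *m X](sum_block_part g v) mulmx_sumr.
apply: (@le_trans _ _ (\sum_i \sum_j a i j *
    ((norm2 (block_part f i y) ^+ 2 + norm2 (block_part g j v) ^+ 2) / 2))).
  apply: ler_sum => i _; rewrite block_part_sum.
  have -> (w : I -> 'cV[R]_m) u : dotv u (\sum_j w j) = \sum_j dotv u (w j).
    by rewrite (big_morph (dotv u) (fun x z => innerDr (dotvP m) x z u) (inner0r (dotvP m) u)).
  apply: ler_sum => j _; apply: le_trans (dotv_le _ _) _.
  apply: le_trans (ler_wpM2l (norm2_ge0 _) (M_le i j v)) _.
  rewrite mulrCA ler_wpM2l //.
  set p := norm2 _; set q := norm2 _.
  by have := sqr_ge0 (p - q); lra.
have -> : \sum_i \sum_j a i j *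
    ((norm2 (block_part f i y) ^+ 2 + norm2 (block_part g j v) ^+ 2) / 2) =
  (\sum_i (\sum_j a i j) * dotv (block_part f i y) (block_part f i y)
   + \sum_j (\sum_i a i j) * dotv (block_part g j v) (block_part g j v)) / 2.
  rewrite mulrDl.
  under [X in _ = _ + X / 2]eq_bigr do rewrite mulr_suml.
  rewrite [X in _ = _ + X / 2]exchange_big /= !mulr_suml -big_split /=.
  apply: eq_bigr => i _; rewrite !mulr_suml -big_split /=; apply: eq_bigr => j _.
  by rewrite !sqr_norm2; ring.
rewrite ler_pM2r ?invr_gt0 // mulrDr -(dotv_block_part f y) -(dotv_block_part g v).
by apply: lerD; rewrite mulr_sumr; apply: ler_sum => i _;
  rewrite ler_wpM2r // (inner_ge0 (dotvP _)).
Qed.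

End BlockNorm.

(** * Summing the gain decay over a graph of subexponential growth *)

Section TruncationBound.
Variables (R : realType) (N : nat) (e : rel 'I_N).
Hypothesis e_sym : symmetric e.
Variables (p : nat -> R) (r dl Up : R).
Hypotheses (r0 : 0 < r) (rdl : r < dl) (dl1 : dl < 1) (Up0 : 0 < Up).
Hypothesis p_sub : subexponential p.
Hypothesis p_growth : forall (i : 'I_N) (d : nat),
  #|[set j : 'I_N | gdist e i j == Some d]%SET|%:R <= p d.

Let M := sup (range (fun d : nat => p d * (r / dl) ^+ d)).
Let dl0 : 0 < dl. Proof. exact: lt_trans r0 rdl. Qed.

(** Subexponential growth is applied at the ratio [r / dl < 1]: a convergent sequence is bounded, so
    the supremum in [Psi] is a true upper bound. *)
Lemma growth_le_sup d : p d * (r / dl) ^+ d <= M.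
Proof.
have q01 : 0 < r / dl < 1 by rewrite divr_gt0 //= ltr_pdivrMr // mul1r.
have [p0 /(_ _ q01) cv] := p_sub.
apply: ub_le_sup; last by exists d.
have [c [_ c_bnd]] := cvg_seq_bounded (cvgP _ cv).
exists (c + 1) => _ [k _ <-].
have := c_bnd (c + 1) _ k I; rewrite ltrDl ltr01 => /(_ isT).
exact: le_trans (ler_norm _).
Qed.

Lemma geometric_tail k D :
  \sum_(d < D | (k < d)%N) dl ^+ d <= dl ^+ k.+1 / (1 - dl).
Proof.
have s_gt0 : 0 < 1 - dl by rewrite subr_gt0.
(* The [maxn] makes the closed form right for the empty sum too, when [D] does not exceed [k.+1]. *)
suff -> : \sum_(d < D | (k < d)%N) dl ^+ d =
    (dl ^+ k.+1 - dl ^+ (maxn D k.+1)) / (1 - dl).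
  by rewrite ler_pM2r ?invr_gt0 // gerBl exprn_ge0 // ltW.
elim: D => [|D IH]; first by rewrite big_ord0 max0n subrr mul0r.
rewrite big_mkcond big_ord_recr -big_mkcond /= {}IH; case: ltnP => kD.
  rewrite (maxn_idPl kD) (maxn_idPl (ltnW kD : k < D.+1)%N).
  by rewrite (exprS _ D); field; rewrite gt_eqF.
by rewrite addr0 !(maxn_idPr _) // ?ltnS // ltnW.
Qed.

(** Bound for a block of the truncation error: no error within distance [k], and none between
    disconnected nodes, where the optimal gain itself vanishes. *)
Definition tail_weight (k : nat) (i j : 'I_N) : R :=
  if gdist e i j is Some d then if (k < d)%N then Up * r ^+ d else 0 else 0.

Lemma tail_weight_ge0 k i j : 0 <= tail_weight k i j.
Proof.
rewrite /tail_weight; case: gdist => // d; case: ifP => // _.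
by rewrite mulr_ge0 ?exprn_ge0 ?ltW.
Qed.

Lemma tail_weight_sym k i j : tail_weight k i j = tail_weight k j i.
Proof. by rewrite /tail_weight gdist_sym. Qed.

Lemma tail_weight_sum k i :
  \sum_j tail_weight k i j <= M * (Up * dl / (1 - dl)) * dl ^+ k.
Proof.
have s_gt0 : 0 < 1 - dl by rewrite subr_gt0.
(* One more than every finite distance from [i]; unreachable nodes default to 0 and have weight 0
   anyway. *)
pose D := (\max_j odflt 0 (gdist e i j)).+1.
have -> : \sum_j tail_weight k i j =
    \sum_(d < D | (k < d)%N) \sum_(j | gdist e i j == Some (d : nat)) Up * r ^+ d.
  rewrite (exchange_big_dep xpredT) //=; apply: eq_bigr => j _.
  rewrite /tail_weight; case E: (gdist e i j) => [d|]; last first.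
    by rewrite big_pred0 // => d; rewrite andbF.
  have dD : (d < D)%N.
    rewrite ltnS; have := @leq_bigmax _ (fun j => odflt 0%N (gdist e i j)) j.
    by rewrite E.
  case: ifP => kd.
    rewrite (big_pred1 (Ordinal dD)) // => d'.
    rewrite /= -val_eqE /=; apply/andP/eqP => [[_ /eqP[->//]]|->].
    by rewrite kd eqxx.
  rewrite big_pred0 // => d'; apply/negP => /andP[h /eqP[dd]].
  by rewrite dd h in kd.
apply: (@le_trans _ _ (\sum_(d < D | (k < d)%N) Up * M * dl ^+ d)).
  apply: ler_sum => d _; rewrite sumr_const -mulr_natr -!mulrA ler_pM2l //.
  apply: (@le_trans _ _ (r ^+ d * p d)).
    rewrite ler_wpM2l ?exprn_ge0 ?(ltW r0) //.
    by have := p_growth i d; rewrite cardsE.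
  (* Part of the decay is spent on taming the growth [p]; the rate [dl] remains for the geometric
     tail. *)
  have -> : r ^+ d * p d = p d * (r / dl) ^+ d * dl ^+ d.
    by rewrite expr_div_n -mulrA divfK ?gt_eqF ?exprn_gt0 // mulrC.
  by rewrite ler_wpM2r ?exprn_ge0 ?(ltW dl0) // growth_le_sup.
have M0 : 0 <= M.
  apply: le_trans (growth_le_sup 0); rewrite mulr1.
  by have [] := p_sub.
rewrite -mulr_sumr; apply: le_trans (ler_wpM2l _ (geometric_tail k D)) _.
  by rewrite mulr_ge0 // ltW.
by rewrite exprS le_eqVlt; apply/orP; left; apply/eqP; field; rewrite gt_eqF.
Qed.

End TruncationBound.

(** * Perturbation of an exponentially stable matrix *)

Section Lyapunov.
Variables (R : realType) (n : nat) (Phi E : 'M[R]_n) (U r phi eps : R).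
Hypotheses (U1 : 1 <= U) (r0 : 0 <= r) (r1 : r < 1).
Hypotheses (phi0 : 0 <= phi) (eps0 : 0 <= eps).
Hypothesis Phi_decay : forall t v, norm2 (Phi ^+ t *m v) <= U * r ^+ t * norm2 v.
Hypothesis Phi_le : forall v, norm2 (Phi *m v) <= phi * norm2 v.
Hypothesis E_le : forall v, norm2 (E *m v) <= eps * norm2 v.

Let W := U ^+ 2 / (1 - r ^+ 2).
Hypothesis small : W * eps * (2 * phi + eps) <= 1 / 2.

Let orbit (v : 'cV[R]_n) : nat -> 'cV[R]_n := fun t => Phi ^+ t *m v.
Let VT T (v : 'cV[R]_n) : R := inner_sum (@dotv R n) T (orbit v) (orbit v).
(** The Lyapunov function as a supremum of partial sums, so that estimates uniform in [T] suffice
    and no series has to be manipulated. *)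
Let V (v : 'cV[R]_n) : R := sup (range (VT ^~ v)).

Let s_gt0 : 0 < 1 - r ^+ 2.
Proof. by rewrite subr_gt0 expr_lt1. Qed.

Let W1 : 1 <= W.
Proof.
rewrite /W ler_pdivlMr // mul1r; apply: (@le_trans _ _ 1).
  by rewrite gerBl sqr_ge0.
by rewrite exprn_ege1.
Qed.

Let VT_le T v : VT T v <= W * norm2 v ^+ 2.
Proof.
have h t : dotv (orbit v t) (orbit v t) <= U ^+ 2 * norm2 v ^+ 2 * (r ^+ 2) ^+ t.
  have le := Phi_decay t v; have ge0 := le_trans (norm2_ge0 _) le.
  by rewrite -sqr_norm2 exprAC mulrAC -!exprMn ler_pXn2r ?nnegrE ?norm2_ge0.
apply: (@le_trans _ _ (U ^+ 2 * norm2 v ^+ 2 * \sum_(t < T) (r ^+ 2) ^+ t)).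
  by rewrite mulr_sumr; apply: ler_sum => t _; apply: h.
have -> : W * norm2 v ^+ 2 = U ^+ 2 * norm2 v ^+ 2 * (1 - r ^+ 2)^-1.
  by rewrite /W mulrAC.
apply: ler_wpM2l; first exact: mulr_ge0 (sqr_ge0 _) (sqr_ge0 _).
rewrite -(ler_pM2l s_gt0) divff ?gt_eqF //.
rewrite -[1 - r ^+ 2]opprB mulNr -subrX1 opprB gerBl.
by rewrite exprn_ge0 ?sqr_ge0.
Qed.

Let VT_leV T v : VT T v <= V v.
Proof.
apply: ub_le_sup; last by exists T.
by exists (W * norm2 v ^+ 2) => _ [T' _ <-]; apply: VT_le.
Qed.

Let V_ge v c : (forall T, VT T v <= c) -> V v <= c.
Proof.
by move=> h; apply: ge_sup => [|_ [T _ <-]//]; exists (VT 0 v), 0%N.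
Qed.

Let V_lower v : norm2 v ^+ 2 <= V v.
Proof.
apply: le_trans (VT_leV 1 v).
by rewrite /VT /inner_sum big_ord1 /orbit expr0 mul1mx sqr_norm2.
Qed.

Let V_upper v : V v <= W * norm2 v ^+ 2.
Proof. by apply: V_ge => T; apply: VT_le. Qed.

Let V_step v : V (Phi *m v) <= V v - norm2 v ^+ 2.
Proof.
apply: V_ge => T; rewrite lerBrDr; apply: le_trans (VT_leV T.+1 v).
rewrite /VT /inner_sum big_ord_recl addrC /orbit /= expr0 mul1mx sqr_norm2 lerD2l.
by apply: ler_sum => t _; rewrite /bump /= add1n expmxSr mulmxA.
Qed.

(** Orbits are linear in their starting point, so Cauchy-Schwarz on the horizon bounds the cross
    term, each orbit having norm at most the square root of [W] times its start. *)
Let V_add a b : V (a + b) <= V a + W * (2 * norm2 a * norm2 b + norm2 b ^+ 2).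
Proof.
have W0 : 0 <= W by apply: le_trans W1.
have dP T := semi_inner_sum (@dotvP R n) T.
apply: V_ge => T.
have -> : VT T (a + b) = VT T a + 2 * inner_sum (@dotv R n) T (orbit a) (orbit b) + VT T b.
  rewrite /VT; have -> : orbit (a + b) = orbit a + orbit b.
    by apply/funext => t; rewrite /orbit mulmxDr.
  rewrite (innerDl (dP T)) !(innerDr (dP T)) (innerC (dP T) (orbit b) (orbit a)).
  by rewrite /VT; ring.
have sn v : snorm (inner_sum (@dotv R n) T) (orbit v) <= Num.sqrt W * norm2 v.
  rewrite -(ler_pXn2r (_ : 0 < 2)%N) ?nnegrE ?mulr_ge0 ?snorm_ge0 ?sqrtr_ge0 ?norm2_ge0 //.
  by rewrite (sqr_snorm (dP T)) exprMn (sqr_sqrtr W0) VT_le.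
have cross : inner_sum (@dotv R n) T (orbit a) (orbit b) <= W * (norm2 a * norm2 b).
  apply: le_trans (inner_le (dP T) _ _) _.
  have -> : W * (norm2 a * norm2 b) = (Num.sqrt W * norm2 a) * (Num.sqrt W * norm2 b).
    by rewrite [RHS]mulrACA -(expr2 (Num.sqrt W)) (sqr_sqrtr W0).
  by apply: ler_pM; rewrite ?snorm_ge0 ?sn.
by have := VT_leV T a; have := VT_le T b; lra.
Qed.

(** Along [Phi] the function [V] drops by the squared norm of the state; by [small] the perturbation
    returns at most half of it, and the other half is at least [V / (2 W)]. Square roots appear
    because [V] is quadratic. *)
Lemma perturbed_decay t v :
  norm2 ((Phi + E) ^+ t *m v) <= Num.sqrt W * Num.sqrt (1 - 1 / (2 * W)) ^+ t * norm2 v.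
Proof.
have W_gt0 : 0 < W by apply: lt_le_trans W1.
have b0 : 0 <= 1 - 1 / (2 * W).
  have W2_gt0 : 0 < 2 * W by rewrite mulr_gt0.
  by rewrite subr_ge0 (ler_pdivrMr _ _ W2_gt0) mul1r; have := W1; lra.
have step w : V ((Phi + E) *m w) <= (1 - 1 / (2 * W)) * V w.
  rewrite mulmxDl; apply: le_trans (V_add _ _) _.
  have h1 := V_step w; have h2 := V_upper w.
  have h3 : W * (2 * norm2 (Phi *m w) * norm2 (E *m w) + norm2 (E *m w) ^+ 2)
      <= 1 / 2 * norm2 w ^+ 2.
    apply: (@le_trans _ _ (W * eps * (2 * phi + eps) * norm2 w ^+ 2)); last first.
      by rewrite ler_wpM2r ?sqr_ge0.
    have -> : W * eps * (2 * phi + eps) * norm2 w ^+ 2 =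
      W * (2 * (phi * norm2 w) * (eps * norm2 w) + (eps * norm2 w) ^+ 2) by ring.
    rewrite ler_wpM2l ?(ltW W_gt0) //; apply: lerD.
      by apply: ler_pM; rewrite ?mulr_ge0 ?norm2_ge0 // ler_pM2l.
    by rewrite ler_pXn2r ?nnegrE ?mulr_ge0 ?norm2_ge0.
  have h4 : 1 / (2 * W) * V w <= 1 / 2 * norm2 w ^+ 2.
    have -> : 1 / 2 * norm2 w ^+ 2 = 1 / (2 * W) * (W * norm2 w ^+ 2).
      by field; rewrite gt_eqF.
    by rewrite ler_wpM2l // divr_ge0 // mulr_ge0 // ltW.
  by lra.
have iter_le : V ((Phi + E) ^+ t *m v) <= (1 - 1 / (2 * W)) ^+ t * V v.
  elim: t => [|t IH]; first by rewrite !expr0 mul1mx mul1r.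
  rewrite expmxS -mulmxA exprS -mulrA; apply: le_trans (step _) _.
  by rewrite ler_wpM2l.
rewrite -(ler_pXn2r (_ : 0 < 2)%N) ?nnegrE ?mulr_ge0 ?norm2_ge0 ?exprn_ge0 ?sqrtr_ge0 //.
apply: le_trans (V_lower _) _; apply: le_trans iter_le _.
rewrite !exprMn (sqr_sqrtr (ltW W_gt0)) exprAC (sqr_sqrtr b0).
by rewrite [leRHS]mulrAC mulrC ler_wpM2r ?exprn_ge0.
Qed.

End Lyapunov.

(** * Stability of the truncated policy *)

Lemma lqr_problemP (R : realType) (n m : nat) (L alpha gamma : R)
    (A : 'M[R]_n) (B : 'M[R]_(n, m)) (Q : 'M[R]_n) (Rc : 'M[R]_m) (Qhalf : 'M[R]_n) :
  1 < L -> 0 < alpha < 1 -> 0 < gamma < 1 ->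
  opnorm A <= L -> opnorm B <= L -> opnorm Q <= L -> opnorm Rc <= L ->
  loewner_ge Rc gamma%:M -> stabilizable L alpha A B ->
  is_psd_sqrt Q Qhalf -> detectable L alpha A Qhalf ->
  lqr_problem L alpha gamma A B Q Rc.
Proof.
move=> L1 /andP[al0 al1] /andP[ga0 ga1] A_le B_le Q_le R_le [Rs R_ge].
move=> [K [K_le K_st]] [[C_sym _] C2] [D [D_le D_st]].
have L0 : 0 <= L by rewrite ltW // (lt_trans ltr01).
split=> //; try by move=> v; apply: norm2_mulmx.
- by move: Rs; rewrite linearB /= tr_scalar_mx => /addIr.
- move=> v; have := R_ge v; rewrite -mulmxA -/(dotv v _) mulmxBl.
  by rewrite (innerBr (dotvP m)) mul_scalar_mx (innerZr (dotvP m)) subr_ge0.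
- exists K; split=> [v|t v]; first exact: norm2_mulmx.
  exact: norm2_mulmx.
- exists Qhalf, D^T; split.
  + by rewrite C_sym C2.
  + by apply: norm2_trmx => // v; apply: norm2_mulmx.
  + move=> t v; have -> : A - D^T *m Qhalf = (A^T - Qhalf^T *m D)^T.
      by rewrite linearB /= trmx_mul !trmxK.
    rewrite expmx_tr; apply: norm2_trmx => [|w]; first by rewrite mulr_ge0 ?exprn_ge0 ?(ltW al0).
    by apply: norm2_mulmx; apply: D_st.
Qed.

Lemma beta_bounds (R : realType) (L alpha gamma : R) :
  1 < L -> 0 < alpha < 1 -> 0 < gamma < 1 -> 0 < beta L alpha gamma < 1.
Proof.
move=> L1 /andP[al0 al1] /andP[ga0 _].
have U1 := Upsilon_ge1 L1 al0 al1 ga0.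
have [r0 r1] := (rho_gt0 L1 al0 al1 ga0, rho_lt1 L1 al0 al1 ga0).
rewrite /beta; set U := Upsilon _ _ _ in U1 *; set r := rho _ _ _ in r0 r1 *.
have r2 : 0 < r ^+ 2 < 1 by rewrite exprn_gt0 //= expr_lt1 // ltW.
have U2 : 1 <= U ^+ 2 by rewrite exprn_ege1.
have q : 0 < (1 - r ^+ 2) / (2 * U ^+ 2) < 1.
  have d0 : 0 < 2 * U ^+ 2 by rewrite mulr_gt0 // (lt_le_trans ltr01).
  case/andP: r2 => r20 r21; rewrite divr_gt0 ?subr_gt0 //=.
  by rewrite (ltr_pdivrMr _ _ d0) mul1r; lra.
case/andP: q => q0 q1; rewrite sqrtr_gt0 subr_gt0 q1 /=.
rewrite -(ltr_pXn2r (_ : 0 < 2)%N) ?nnegrE ?sqrtr_ge0 // sqr_sqrtr ?subr_ge0 ?ltW //.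
by rewrite expr1n gtrBl.
Qed.

(** * Application to the truncated gain *)

Section Truncation.
Variables (R : realType) (N : nat) (e : rel 'I_N) (nx nu : 'I_N -> nat).
Hypothesis e_sym : symmetric e.
Variables (L alpha gamma : R) (A : 'M[R]_(\sum_i nx i)).
Variables (B : 'M[R]_(\sum_i nx i, \sum_j nu j)).
Variables (Q : 'M[R]_(\sum_i nx i)) (Rc : 'M[R]_(\sum_i nu i)).
Hypothesis pb : lqr_problem L alpha gamma A B Q Rc.

(** Diagonal blocks are unconstrained, so each node counts as its own neighbour. *)
Definition adjacent : rel 'I_N := fun i j => (i == j) || e i j.

Lemma mxblock_sparse (m n : 'I_N -> nat) (Mb : forall i j, 'M[R]_(m i, n j)) :
  graph_sparse e Mb ->
  mx_sparse adjacent (@tagnat.sig1 _ m) (@tagnat.sig1 _ n) (\mxblock_(i, j) Mb i j).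
Proof.
move=> sp s s' /norP[ij nij]; rewrite mxE sp //.
by rewrite mxE.
Qed.

Local Notation fx := (@tagnat.sig1 _ nx).
Local Notation fu := (@tagnat.sig1 _ nu).
Hypotheses (As : mx_sparse adjacent fx fx A) (Bs : mx_sparse adjacent fx fu B).
Hypotheses (Qs : mx_sparse adjacent fx fx Q) (Rs : mx_sparse adjacent fu fu Rc).
Variable P : 'M[R]_(\sum_i nx i).
Hypotheses (P_psd : psdmx P) (P_dare : dare A B Q Rc P).
Variable p : nat -> R.
Hypothesis p_sub : subexponential p.
Hypothesis p_growth : forall (i : 'I_N) (d : nat),
  #|[set j : 'I_N | gdist e i j == Some d]%SET|%:R <= p d.

Local Notation K := (lqr_gain A B Rc P).
Local Notation rh := (rho L alpha gamma).
Local Notation Up := (Upsilon L alpha gamma).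
Local Notation dl := (delta L alpha gamma).
Local Notation Ps := (Psi L alpha gamma p).

Let L1 := lqr_L pb.
Let al0 := lqr_alpha0 pb.
Let al1 := lqr_alpha1 pb.
Let ga0 := lqr_gamma0 pb.
Let r_gt0 := rho_gt0 L1 al0 al1 ga0.
Let r_lt1 := rho_lt1 L1 al0 al1 ga0.
Let r_dl := rho_lt_delta L1 al0 al1 ga0.
Let dl_gt0 : 0 < dl := lt_trans r_gt0 r_dl.
Let dl_lt1 : dl < 1. Proof. by have [] := delta_bounds L1 al0 al1 ga0. Qed.
Let Up_gt0 : 0 < Up. Proof. exact: lt_le_trans ltr01 (Upsilon_ge1 L1 al0 al1 ga0). Qed.

Lemma block_gain_decay i j d v : (forall r, (r < d)%N -> ~~ gdist_le e i j r) ->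
  norm2 (block_part fu i (K *m block_part fx j v)) <=
  Up * rh ^+ d * norm2 (block_part fx j v).
Proof.
have adj_sym : symmetric adjacent by move=> x y; rewrite /adjacent eq_sym e_sym.
apply: (gain_decay pb P_psd P_dare adj_sym As Bs Qs Rs
  (ball := fun r k => gdist_le e k j r)).
- by move=> r k /gdist_leP[n nr w]; apply/gdist_leP; exists n => //; apply: leqW.
- move=> r k k' /gdist_leP[n nr w] /orP[/eqP->|ekk'].
    by apply/gdist_leP; exists n => //; apply: leqW.
  by apply/gdist_leP; exists n.+1 => //; apply: walkS ekk' w.
move=> s far; rewrite mxE; case: eqP => // sj.
by case/negP: far; rewrite sj; apply/gdist_leP; exists 0%N => //; apply: walk0.
Qed.

Lemma truncateE k s s' :
  truncate e k K s s' = if gdist_le e (fu s) (fx s') k then K s s' else 0.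
Proof. by rewrite mxE; case: ifP => _; rewrite mxE ?tagnat.sig2K. Qed.

Lemma block_gain_error i j k v :
  norm2 (block_part fu i ((K - truncate e k K) *m block_part fx j v)) <=
  tail_weight e rh Up k i j * norm2 (block_part fx j v).
Proof.
have -> : block_part fu i ((K - truncate e k K) *m block_part fx j v) =
    if gdist_le e i j k then 0 else block_part fu i (K *m block_part fx j v).
  apply/matrixP => s c; rewrite (ord1 c) mxE.
  have -> : (if gdist_le e i j k then 0 else block_part fu i (K *m block_part fx j v)) s 0
    = if gdist_le e i j k then 0 else block_part fu i (K *m block_part fx j v) s 0.
    by case: ifP => _ //; rewrite mxE.
  rewrite [block_part _ _ _ _ _]mxE; case: eqP => [si|_]; last by case: ifP.
  rewrite mulmxBl mxE [X in _ + X]mxE.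
  have -> : (truncate e k K *m block_part fx j v) s 0 =
    if gdist_le e i j k then (K *m block_part fx j v) s 0 else 0.
    transitivity (\sum_s' (if gdist_le e i j k then K s s' else 0)
        * block_part fx j v s' 0).
      rewrite mxE; apply: eq_bigr => s' _; rewrite truncateE si.
      have [->//|s'j] := eqVneq (fx s') j.
      by rewrite [block_part _ _ _ _ _]mxE (negPf s'j) !mulr0.
    case: ifP => _; first by rewrite [RHS]mxE.
    by rewrite big1 // => s' _; rewrite mul0r.
  by case: ifP => _; rewrite ?subrr ?subr0.
rewrite /tail_weight /gdist_le; have := gdistP e i j.
case E: (gdist e i j) => [d|] h.
  rewrite leqNgt; case: (ltnP k d) => kd /=; last first.
    by rewrite mul0r norm2E (snorm0 (dotvP _)).
  apply: block_gain_decay => r rd; rewrite /gdist_le E -ltnNge //.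
(* For a disconnected pair the decay estimate holds at every distance [T], so the gain block is
   0. *)
rewrite mul0r; apply: (@le_of_geometric _ _ _
  (Up * norm2 (block_part fx j v)) rh) => // [|T]; first exact: ltW.
rewrite add0r mulrAC; apply: block_gain_decay => r _.
by rewrite /gdist_le E.
Qed.

Lemma truncated_stable k : kappabar L alpha gamma p <= k%:R ->
  stable (Omega L alpha gamma) (beta L alpha gamma) (A - B *m truncate e k K).
Proof.
move=> k_ge t; apply: opnorm_le => [|v].
  by rewrite mulr_ge0 ?sqrtr_ge0 // exprn_ge0 ?sqrtr_ge0.
(* The empty network is set apart because a node is needed for [p 0 >= 1], hence for [Psi > 0]. *)
have [[i0 _]|no_node] := pselect (exists i : 'I_N, True); last first.
  have norm0 (w : 'cV[R]_(\sum_i nx i)) : norm2 w = 0.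
    rewrite /norm2 big1 ?sqrtr0 // => s _.
    by case: no_node; exists (fx s).
  by rewrite !norm0 mulr0.
have L_gt0 : 0 < L by apply: lt_trans L1.
have s_gt0 : 0 < 1 - dl by rewrite subr_gt0.
pose q := Up * dl / (1 - dl).
have q_gt0 : 0 < q by rewrite divr_gt0 // mulr_gt0.
have Ps_gt0 : 0 < Ps.
  rewrite /Psi mulr_gt0 //; apply: lt_le_trans (growth_le_sup r_gt0 r_dl p_sub 0).
  rewrite mulr1; apply: lt_le_trans (p_growth i0 0); rewrite ltr0n.
  apply/card_gt0P; exists i0; rewrite inE; apply/eqP.
  have := gdistP e i0 i0; case: gdist => [d [_ h]|h]; last by have := h 0%N; rewrite walk0.
  by have := h _ (walk0 e i0); rewrite leqn0 => /eqP ->.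
have [Kb [Kb_le Kb_stable]] := lqr_stab pb.
pose c := LP L alpha * L ^+ 2 / gamma.
have K_le w : norm2 (K *m w) <= c * norm2 w.
  exact: (gain_norm_le (ltW L_gt0) (ltW al0) al1 ga0 (lqr_A pb) (lqr_B pb) (lqr_Q pb)
    (lqr_R pb) (lqr_R_sym pb) (lqr_R_ge pb) P_psd P_dare Kb_le Kb_stable).
have c_gt0 : 0 < c by rewrite divr_gt0 // mulr_gt0 ?exprn_gt0 // (LP_pos pb).
pose phi := L * (1 + c).
pose eps := L * (Ps * dl ^+ k).
have E_le w : norm2 ((B *m (K - truncate e k K)) *m w) <= eps * norm2 w.
  rewrite -mulmxA /eps -mulrA; apply: le_trans (lqr_B pb _) _.
  rewrite ler_pM2l //.
  apply: (block_schur (a := tail_weight e rh Up k)) => [|i j|i j u|i|j].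
  - by rewrite mulr_gt0 // exprn_gt0.
  - exact: tail_weight_ge0.
  - exact: block_gain_error.
  - exact: (tail_weight_sum r_gt0 r_dl dl_lt1 Up_gt0 p_sub p_growth).
  under eq_bigr do rewrite tail_weight_sym //.
  exact: (tail_weight_sum r_gt0 r_dl dl_lt1 Up_gt0 p_sub p_growth).
have Phi_le w : norm2 ((A - B *m K) *m w) <= phi * norm2 w.
  rewrite mulmxBl -mulmxA norm2E.
  apply: le_trans (snormB (dotvP _) _ _) _; rewrite -!norm2E /phi mulrDr mulr1 mulrDl.
  apply: lerD; first exact: lqr_A pb w.
  by apply: le_trans (lqr_B pb _) _; rewrite -mulrA ler_pM2l.
have -> : A - B *m truncate e k K = (A - B *m K) + B *m (K - truncate e k K).
  by rewrite mulmxBr addrA subrK.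
pose X := (1 - rh ^+ 2) / (2 * Up ^+ 2 * Ps * L * (L * Ps + 2 * L * (1 + c))).
have r2 : 0 < 1 - rh ^+ 2 by rewrite subr_gt0 expr_lt1 // ltW.
have c1_gt0 : 0 < 1 + c by rewrite addr_gt0.
have D_gt0 : 0 < L * Ps + 2 * L * (1 + c).
  exact: addr_gt0 (mulr_gt0 L_gt0 Ps_gt0) (mulr_gt0 (mulr_gt0 (ltr0Sn _ 1) L_gt0) c1_gt0).
have X_gt0 : 0 < X.
  apply: divr_gt0 r2 (mulr_gt0 (mulr_gt0 (mulr_gt0 _ Ps_gt0) L_gt0) D_gt0).
  exact: mulr_gt0 (ltr0Sn _ 1) (exprn_gt0 2 Up_gt0).
have dlk_gt0 : 0 < dl ^+ k by rewrite exprn_gt0.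
have eps_gt0 : 0 < eps := mulr_gt0 L_gt0 (mulr_gt0 Ps_gt0 dlk_gt0).
have phi_gt0 : 0 < phi := mulr_gt0 L_gt0 c1_gt0.
(* This is [kappabar <= k] exponentiated; dividing by the negative [ln dl] reverses the
   inequality. *)
have dlk_le : dl ^+ k <= X.
  rewrite -ler_ln ?posrE // lnXn // -mulr_natl.
  have ln_dl : ln dl < 0 by rewrite ln_lt0 // dl_gt0 dl_lt1.
  have := k_ge; rewrite /kappabar -/c -/X div1r mulrC.
  by rewrite ler_ndivrMr.
have dlk_le1 : dl ^+ k <= 1 by rewrite exprn_ile1 // ltW.
(* Origin of [kappabar]: bounding [dl ^+ k] by [X] in [eps] and by 1 in the last factor gives
   exactly one half. *)
have small : Up ^+ 2 / (1 - rh ^+ 2) * eps * (2 * phi + eps) <= 1 / 2.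
  apply: (@le_trans _ _ (Up ^+ 2 / (1 - rh ^+ 2) * (L * (Ps * X)) *
      (L * Ps + 2 * L * (1 + c)))).
    have W0 : 0 <= Up ^+ 2 / (1 - rh ^+ 2) by rewrite divr_ge0 ?sqr_ge0 // ltW.
    apply: ler_pM.
    - exact: mulr_ge0 W0 (ltW eps_gt0).
    - exact: addr_ge0 (mulr_ge0 (ler0n _ 2) (ltW phi_gt0)) (ltW eps_gt0).
    - by rewrite /eps ler_wpM2l // !ler_pM2l.
    rewrite addrC /phi mulrA lerD2r /eps ler_pM2l //.
    by rewrite ler_piMr // ltW.
  rewrite /X le_eqVlt; apply/orP; left; apply/eqP.
  by field; rewrite !gt_eqF.
have -> : Omega L alpha gamma = Num.sqrt (Up ^+ 2 / (1 - rh ^+ 2)) by [].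
have -> : beta L alpha gamma = Num.sqrt (1 - 1 / (2 * (Up ^+ 2 / (1 - rh ^+ 2)))).
  by rewrite /beta; congr (Num.sqrt (1 - _)); field; rewrite !gt_eqF.
apply: (perturbed_decay (phi := phi) (eps := eps)) => //.
- exact: Upsilon_ge1 L1 al0 al1 ga0.
- exact: ltW.
- exact: ltW.
- by move=> t' w; have := closed_loop_decay pb P_psd P_dare t' w.
Qed.

End Truncation.

Theorem theorem4p1 (R : realType) (N : nat) (e : rel 'I_N)
    (e_sym : symmetric e) (e_irr : irreflexive e)
    (nx nu : 'I_N -> nat)
    (Ab : forall i j, 'M[R]_(nx i, nx j)) (Bb : forall i j, 'M[R]_(nx i, nu j))
    (Qb : forall i j, 'M[R]_(nx i, nx j)) (Rb : forall i j, 'M[R]_(nu i, nu j))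
    (Qb_sym : forall i j, Qb i j = (Qb j i)^T)
    (Rb_sym : forall i j, Rb i j = (Rb j i)^T)
    (Ab_sparse : graph_sparse e Ab) (Bb_sparse : graph_sparse e Bb)
    (Qb_sparse : graph_sparse e Qb) (Rb_sparse : graph_sparse e Rb)
    (A : 'M[R]_(\sum_i nx i)) (B : 'M[R]_(\sum_i nx i, \sum_j nu j))
    (Q : 'M[R]_(\sum_i nx i)) (Rc : 'M[R]_(\sum_i nu i))
    (defA : A = \mxblock_(i, j) Ab i j) (defB : B = \mxblock_(i, j) Bb i j)
    (defQ : Q = \mxblock_(i, j) Qb i j) (defRc : Rc = \mxblock_(i, j) Rb i j)
    (L alpha gamma : R)
    (L_gt1 : 1 < L) (alpha_01 : 0 < alpha < 1) (gamma_01 : 0 < gamma < 1)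
    (A_le : opnorm A <= L) (B_le : opnorm B <= L)
    (Q_le : opnorm Q <= L) (Rc_le : opnorm Rc <= L)
    (Rc_ge : loewner_ge Rc gamma%:M)
    (AB_stab : stabilizable L alpha A B)
    (Q_psd : loewner_ge Q 0)
    (Qhalf : 'M[R]_(\sum_i nx i)) (QhalfP : is_psd_sqrt Q Qhalf)
    (AQ_detect : detectable L alpha A Qhalf)
    (p : nat -> R) (p_subexp : subexponential p)
    (p_growth : forall (i : 'I_N) (d : nat),
       #|[set j : 'I_N | gdist e i j == Some d]%SET|%:R <= p d) :
  (forall Pstar : 'M[R]_(\sum_i nx i),
     psdmx Pstar -> dare A B Q Rc Pstar ->
   forall kappa : nat, kappabar L alpha gamma p <= kappa%:R ->
     stable (Omega L alpha gamma) (beta L alpha gamma)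
       (A - B *m truncate e kappa (lqr_gain A B Rc Pstar)))
  /\ 0 < beta L alpha gamma < 1.
Proof.
have pb : lqr_problem L alpha gamma A B Q Rc by apply: lqr_problemP QhalfP AQ_detect.
split; last exact: beta_bounds.
move=> Pstar P_psd P_dare kappa kappa_ge.
have sA := mxblock_sparse Ab_sparse; have sB := mxblock_sparse Bb_sparse.
have sQ := mxblock_sparse Qb_sparse; have sR := mxblock_sparse Rb_sparse.
rewrite -defA in sA; rewrite -defB in sB; rewrite -defQ in sQ; rewrite -defRc in sR.
exact: (truncated_stable e_sym pb sA sB sQ sR P_psd P_dare p_subexp p_growth).
Qed.
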